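(* Let $n\ge 2$ and let $u:\mathbb{R}\times\mathbb{R}^{n-1}\to\mathbb{R}$ be a smooth convex function, with coordinates $(t,x_2,\dots,x_n)$ and $x_1=t$, satisfying on all of $\mathbb{R}^n$ the Donaldson equation $$u_{11}\,(u_{22}+u_{33}+\cdots+u_{nn})-u_{12}^2-\cdots-u_{1n}^2=1 .$$ Then $u$ is a quadratic function, i.e. a polynomial of degree at most $2$ in $(t,x_2,\dots,x_n)$.
   Context: Subscripts denote partial derivatives: $u_{ij}=\partial^2u/\partial x_i\partial x_j$, with $x_1=t$. Solutions are understood in the classical (smooth) sense. *)

(* Defs.v *)
From HB Require Import structures.
From mathcomp Require Import all_boot all_order all_algebra.
From mathcomp Require Import all_classical all_reals all_analysis.

Set Implicit Arguments.
Unset Strict Implicit.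
Unset Printing Implicit Defensive.

Import Order.TTheory GRing.Theory Num.Theory.
Import numFieldNormedType.Exports.

Local Open Scope classical_set_scope.
Local Open Scope ring_scope.

Section Donaldson.
Context {R : realType} {n : nat}.
Implicit Types u : 'rV[R]_n -> R.

Definition partial (i : 'I_n) u : 'rV[R]_n -> R := 'D_(delta_mx 0 i) u.

Definition iter_partial (s : seq 'I_n) u : 'rV[R]_n -> R := foldr partial u s.

(* 'D_v is total, with a junk value where the limit does not exist, so the
   existence of every derivative has to be required separately. *)
Definition smooth u : Prop :=
  forall s : seq 'I_n,
    (forall (i : 'I_n) (x : 'rV[R]_n),
       derivable (iter_partial s u) x (delta_mx 0 i)) /\
    continuous (iter_partial s u).

Definition partial2 (i j : 'I_n) u : 'rV[R]_n -> R := partial i (partial j u).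

(* t is the index of the time coordinate; i ranges over the space coordinates. *)
Definition donaldson (t : 'I_n) u (x : 'rV[R]_n) : R :=
  partial2 t t u x * (\sum_(i < n | i != t) partial2 i i u x)
  - \sum_(i < n | i != t) (partial2 t i u x) ^+ 2.

Definition quadratic u : Prop :=
  exists (A : 'M[R]_n) (b : 'rV[R]_n) (c : R),
    forall x : 'rV[R]_n,
      u x = \sum_(i < n) \sum_(j < n) A i j * x 0 i * x 0 j
            + \sum_(i < n) b 0 i * x 0 i + c.

End Donaldson.

(* Main.v *)
Require Import Defs.
From HB Require Import structures.
From mathcomp Require Import all_boot all_order all_algebra.
From mathcomp Require Import all_classical all_reals all_analysis.
From mathcomp Require Import ring lra.
Import Order.TTheory GRing.Theory Num.Theory.
Import numFieldNormedType.Exports.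
Local Open Scope classical_set_scope.
Local Open Scope ring_scope.

Set Implicit Arguments.
Unset Strict Implicit.
Unset Printing Implicit Defensive.

(** The proof is a partial Legendre transform in [t], carried out without leaving the
    coordinates [(t, x)].

    The equation and convexity give [u_tt > 0].  If [sigma = u_t] replaces [t] as a
    coordinate and [v (sigma, x) = sigma t - u], then [v_{sigma sigma} = 1 / u_tt] and
    the spatial Hessian of [v] is minus that of [u] corrected by the mixed terms, so
    that the Donaldson equation becomes [v_{sigma sigma} + Delta_x v = 0]: a linear
    equation.  Hence [v_{sigma sigma} = 1 / u_tt] is a positive harmonic function of
    [(sigma, x)], and a Liouville theorem makes it constant.  The rest is short.  With
    [u_tt] constant, [D^2_x u (xi, xi)] is affine in [t] and nonnegative, thus
    independent of [t]; the mixed derivatives [u_ti] are then constant, the equation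
    says that the spatial Laplacian of [u] is constant, and [1 + D^2_x u (xi, xi)] is
    again positive and harmonic.  So all third derivatives of [u] vanish
    ([third_derivatives0]).

    The change of variables would need the inverse of [t |-> u_t (t, x)] and its
    regularity.  Instead, the coordinate fields of [(sigma, x)] are written in the old
    coordinates, [d_sigma = (1 / u_tt) d_t] and [d_i - (u_ti / u_tt) d_t]; they are
    commuting derivations ([leg_d_comm]) dual to [u_t, x_2, ..., x_n]
    ([leg_d_coord]).  For their Laplacian the function [t] is harmonic
    ([leg_lap_time]), since [t = v_sigma], and therefore so is its [sigma]-derivative
    [1 / u_tt] ([leg_lap_inv_utt]).

    Two analytic facts remain, both obtained from the maximum principle alone.

    - Balls in the coordinates [(u_t, x)] are compact ([compact_balls]), which requires
      [u_t] to be unbounded above and below.  Convexity makes the supremum of [u_t] the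
      same on every line parallel to the [t]-axis ([uniform_growth]).  Were it finite,
      [t] would be a harmonic function tending to infinity on a flat piece of the
      boundary of the domain of [v], and an explicit barrier excludes this
      ([slope_unbounded]).

    - A positive harmonic function [F] satisfies [|grad F| <= C F / r] at the centre of
      a ball of radius [r] ([gradient_estimate], by the method of Cheng and Yau);
      letting [r] grow gives the Liouville theorem ([liouville]). *)

(** * The ring of smooth functions *)

Section SmoothRing.
Context {R : realType} {n : nat}.
Local Notation V := 'rV[R]_n.
Implicit Types f g : V -> R.

(** [smooth] speaks of the iterated partial derivatives of one function, which a product
    does not inherit termwise.  Recursion on the order of differentiability turns
    closure under the ring operations into an induction. *)
Fixpoint Ck (k : nat) f : Prop :=
  continuous f /\
  (if k is k'.+1 then forall i : 'I_n,
    (forall x, derivable f x (delta_mx 0 i)) /\ Ck k' (partial i f) else True).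

Lemma Ck_continuous k f : Ck k f -> continuous f.
Proof. by case: k => [|k] []. Qed.

Lemma Ck_le k f : Ck k.+1 f -> Ck k f.
Proof.
elim: k f => [|k IH] f [cf df]; first by split.
by split=> // i; have [d1 d2] := df i; split=> //; exact: IH.
Qed.

Lemma smoothP f : smooth f <-> forall k, Ck k f.
Proof.
have sp i g : smooth g -> smooth (partial i g).
  move=> sg s; have := sg (rcons s i).
  by rewrite /iter_partial foldr_rcons.
split=> [sf k|Cf s].
  elim: k f sf => [|k IH] f sf; have [d0 c0] := sf [::]; split=> // i.
  by split; [exact: d0|exact: IH (sp _ _ sf)].
elim/last_ind: s f Cf => [|s i IH] f Cf.
  split; last exact: Ck_continuous (Cf 0%N).
  by move=> i x; have [_ /(_ i)[]] := Cf 1%N.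
have /IH : forall k, Ck k (partial i f) by move=> k; have [_ /(_ i)[]] := Cf k.+1.
by rewrite /iter_partial foldr_rcons.
Qed.

Lemma smooth_partial i f : smooth f -> smooth (partial i f).
Proof. by move=> /smoothP Cf; apply/smoothP => k; have [_ /(_ i)[]] := Cf k.+1. Qed.

Lemma smooth_derivable i f x : smooth f -> derivable f x (delta_mx 0 i).
Proof. by move=> sf; have [+ _] := sf [::]; exact. Qed.

Lemma smooth_continuous f : smooth f -> continuous f.
Proof. by move=> sf; have [_] := sf [::]. Qed.

Lemma Ck_cst k (c : R) : Ck k (cst c).
Proof.
elim: k c => [|k IH] c; split=> //; try exact: cst_continuous.
move=> i; split=> [x|]; first exact: derivable_cst.
have -> : partial i (cst c) = cst (0 : R); last exact: IH.
by apply/funext => x; rewrite /partial derive_cst.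
Qed.

Lemma Ck_add k f g : Ck k f -> Ck k g -> Ck k (f + g).
Proof.
elim: k f g => [|k IH] f g [cf df] [cg dg]; split=> //.
- by move=> x; exact: (cvgD (cf x) (cg x)).
- by move=> x; exact: (cvgD (cf x) (cg x)).
move=> i; have [d1 c1] := df i; have [d2 c2] := dg i.
split=> [x|]; first exact: derivableD.
have -> : partial i (f + g) = partial i f + partial i g; last exact: IH.
by apply/funext => x; rewrite /partial deriveD.
Qed.

Lemma Ck_opp k f : Ck k f -> Ck k (- f).
Proof.
elim: k f => [|k IH] f [cf df]; split=> //.
- by move=> x; exact: (cvgN (cf x)).
- by move=> x; exact: (cvgN (cf x)).
move=> i; have [d1 c1] := df i.
split=> [x|]; first exact: derivableN.
have -> : partial i (- f) = - partial i f; last exact: IH.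
by apply/funext => x; rewrite /partial deriveN.
Qed.

Lemma Ck_mul k f g : Ck k f -> Ck k g -> Ck k (f * g).
Proof.
elim: k f g => [|k IH] f g Cf Cg; have [cf df] := Cf; have [cg dg] := Cg; split=> //.
- by move=> x; exact: (cvgM (cf x) (cg x)).
- by move=> x; exact: (cvgM (cf x) (cg x)).
move=> i; have [d1 c1] := df i; have [d2 c2] := dg i.
split=> [x|]; first exact: derivableM.
have -> : partial i (f * g) = f * partial i g + g * partial i f.
  by apply/funext => x; rewrite /partial deriveM.
by apply: Ck_add; apply: IH => //; exact: Ck_le.
Qed.

Lemma Ck_inv k f : (forall x, f x != 0) -> Ck k f -> Ck k (fun x => (f x)^-1).
Proof.
move=> f0; elim: k f f0 => [|k IH] f f0 Cf; have [cf df] := Cf; split=> //.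
- by move=> x; exact: (cvgV (f0 x) (cf x)).
- by move=> x; exact: (cvgV (f0 x) (cf x)).
move=> i; have [d1 c1] := df i.
split=> [x|]; first exact: derivableV.
have -> : partial i (fun x => (f x)^-1) =
   - (partial i f * ((fun x => (f x)^-1) * (fun x => (f x)^-1))).
  apply/funext => x; rewrite /partial deriveV// !fctE.
  by rewrite expr2 invfM scaleNr /GRing.scale /= mulrC.
have Ci : Ck k (fun x => (f x)^-1) by apply: IH => //; exact: Ck_le.
by apply: Ck_opp; apply: Ck_mul => //; exact: Ck_mul.
Qed.

Lemma partial_coord (i j : 'I_n) (x : V) :
  is_derive x (delta_mx 0 i) (fun y : V => y 0 j) ((i == j)%:R).
Proof.
have d : differentiable (fun y : V => y 0 j) x by exact: differentiable_coord.
apply: DeriveDef; first exact: diff_derivable.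
rewrite /derive; apply: cvg_lim => //.
apply: cvg_near_cst; near=> h.
rewrite /= !mxE eqxx /= addrK eq_sym.
have h0 : h != 0 by near: h; exact: nbhs_dnbhs_neq.
by rewrite /GRing.scale /= mulrA mulVf// mul1r.
Unshelve. all: by end_near. Qed.

Lemma Ck_coord k (j : 'I_n) : Ck k (fun y : V => y 0 j).
Proof.
have c : continuous (fun y : V => y 0 j) by exact: coord_continuous.
case: k => [|k]; split=> // i; split=> [x|].
  by have := partial_coord i j x; case.
have -> : partial i (fun y : V => y 0 j) = cst ((i == j)%:R).
  by apply/funext => x; have [_] := partial_coord i j x.
exact: Ck_cst.
Qed.

Definition smooth_pred : {pred V -> R} := fun f => `[< smooth f >].

Lemma smooth_predP f : reflect (smooth f) (f \in smooth_pred).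
Proof. exact: asboolP. Qed.

Lemma smooth_subring : subring_closed smooth_pred.
Proof.
split.
- by apply/smooth_predP/smoothP => k; exact: Ck_cst.
- move=> f g /smooth_predP/smoothP Cf /smooth_predP/smoothP Cg.
  by apply/smooth_predP/smoothP => k; apply: Ck_add => //; exact: Ck_opp.
- move=> f g /smooth_predP/smoothP Cf /smooth_predP/smoothP Cg.
  by apply/smooth_predP/smoothP => k; exact: Ck_mul.
Qed.

HB.instance Definition _ := GRing.isSubringClosed.Build (V -> R) smooth_pred
  smooth_subring.

(** Bundling smoothness makes the smooth functions a commutative ring on which the partial
    derivatives are total derivations, so that identities between derivatives are
    ring identities without side conditions. *)
Record smf := Smf { smf_fun :> V -> R; _ : smf_fun \in smooth_pred }.
HB.instance Definition _ := [isSub for smf_fun].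
HB.instance Definition _ := [Choice of smf by <:].
HB.instance Definition _ := [SubChoice_isSubComNzRing of smf by <:].

End SmoothRing.
Arguments smf : clear implicits.
Arguments smf_fun {R n} _ _ : simpl never.

(** * Directional derivatives, symmetry of second derivatives, maximum test *)

Section Directional.
Context {R : realType} {n : nat}.
Local Notation V := 'rV[R]_n.

Lemma continuous_near_line (G : V -> R) (p v w : V) (e : R) :
  {for p, continuous G} -> 0 < e ->
  exists2 d : R, 0 < d & forall a b : R, `|a| < d -> `|b| < d ->
    `|G (p + a *: v + b *: w) - G p| < e.
Proof.
move=> cG e0.
have /nbhs_normP[/= r r0 Hr] : \forall q \near p, `|G p - G q| < e.
  by move/cvgrPdist_lt: cG; exact.
have N0 : 0 < `|v| + `|w| + 1 by rewrite ltr_wpDl// addr_ge0.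
exists (r / (`|v| + `|w| + 1)); first exact: divr_gt0.
move=> a b ha hb; rewrite distrC; apply: Hr => /=.
rewrite opprD opprD !addrA subrr add0r.
rewrite -opprD normrN (le_lt_trans (ler_normD _ _))// !normrZ.
rewrite ltr_pdivlMr// in ha; rewrite ltr_pdivlMr// in hb.
have := normr_ge0 v; have := normr_ge0 w => hw hv.
have := normr_ge0 a; have := normr_ge0 b => pb pa.
by have [ab|ba] := leP `|a| `|b|; nra.
Qed.

Lemma line_is_derive (F G : V -> R) (e p : V) (r : R) :
  (forall q, is_derive q e F (G q)) ->
  is_derive r (1 : R) (fun s : R => F (p + s *: e)) (G (p + r *: e)).
Proof.
move=> H; have [ex val] := H (p + r *: e).
have E : (fun h : R => h^-1 *: (((fun s : R => F (p + s *: e)) \o shift r) (h *: (1:R))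
    - F (p + r *: e))) =
   (fun h : R => h^-1 *: ((F \o shift (p + r *: e)) (h *: e) - F (p + r *: e))).
  apply/funext => h /=; congr (_ *: (F _ - _)).
  by rewrite [h *: 1]mulr1 scalerDl addrCA.
by apply: DeriveDef; rewrite /derivable /derive E.
Qed.

Lemma MVT_everywhere (q dq : R -> R) (a b : R) : a < b ->
  (forall r, is_derive r (1 : R) q (dq r)) ->
  exists2 c, a < c < b & q b - q a = dq c * (b - a).
Proof.
move=> ab H.
have cq : continuous q.
  move=> r; apply/differentiable_continuous/derivable1_diffP.
  by have [] := H r.
have [c cab E] := MVT ab (fun x _ => H x) (continuous_subspaceT cq).
by exists c => //; rewrite in_itv in cab.
Qed.

(** A function with continuous partial derivatives has all directional derivatives; this
    is the induction step, which adds one coordinate direction.  The increment along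
    [c *: e] starts from the moving point [p + h *: v], and the mean value theorem
    writes it as a value of the continuous derivative [G] near [p]. *)
Lemma is_derive_addZ (F G A : V -> R) (e v : V) (c : R) :
  (forall q, is_derive q e F (G q)) -> continuous G ->
  (forall q, is_derive q v F (A q)) ->
  forall p, is_derive p (v + c *: e) F (A p + c * G p).
Proof.
move=> He cG Hv p.
suff lim1 : (fun h : R => h^-1 *: ((F \o shift p) (h *: (v + c *: e)) - F p)) @ 0^'
    --> A p + c * G p.
  apply: DeriveDef; first by apply/cvg_ex; exists (A p + c * G p).
  exact: cvg_lim.
have -> : (fun h : R => h^-1 *: ((F \o shift p) (h *: (v + c *: e)) - F p)) =
  (fun h : R => h^-1 *: ((F \o shift p) (h *: v) - F p)) +
  (fun h : R => h^-1 *: (F (p + h *: v + (h * c) *: e) - F (p + h *: v))).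
  apply/funext => h; apply: (etrans _ (scalerDr _ _ _)); congr (_ *: _) => /=.
  rewrite [h *: v + p]addrC [RHS]addrAC addrCA subrr addr0.
  by rewrite scalerDr scalerA [X in F X]addrC addrA.
apply: cvgD.
  by have [ex <-] := Hv p; exact: ex.
apply/cvgrPdist_lt => eps eps0.
have k0 : 0 < eps / (`|c| + 1) by rewrite divr_gt0// ltr_wpDl.
have [d d0 Hd] := continuous_near_line v e (cG p) k0.
have d0' : 0 < d / (`|c| + 1) by rewrite divr_gt0// ltr_wpDl.
near=> h.
have h0 : h != 0 by near: h; exact: nbhs_dnbhs_neq.
have hd : `|h| < d / (`|c| + 1).
  near: h; apply: nbhs_dnbhs; exists (d / (`|c| + 1)) => //= y /=.
  by rewrite sub0r normrN.
have dq (r : R) : is_derive r (1 : R) (fun r : R => F (p + h *: v + (r * (h * c)) *: e))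
   ((h * c) * G (p + h *: v + (r * (h * c)) *: e)).
  rewrite (mulrC (h * c) (G _)).
  apply: (@is_derive1_comp _ (fun s : R => F (p + h *: v + s *: e)) (fun r => r * (h * c))).
    exact: line_is_derive.
  have := @is_deriveM _ _ id (cst (h * c)) r 1 1 0 (is_derive_id _ _) (is_derive_cst _ _ _).
  by rewrite /GRing.scale /= mulr0 add0r mulr1.
have [th /andP[th0 th1] /=] := MVT_everywhere ltr01 dq.
rewrite mul1r mul0r scale0r addr0 subr0 mulr1 => ->.
rewrite /GRing.scale /= !mulrA mulVf// mul1r -mulrBr normrM distrC.
have c1 : 0 < `|c| + 1 by rewrite ltr_wpDl.
have ch : `|h| < d.
  apply: (lt_le_trans hd); rewrite ler_pdivrMr// ler_peMr ?(ltW d0)//.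
  by rewrite lerDr.
have hc : `|th * (h * c)| < d.
  rewrite !normrM (gtr0_norm th0).
  rewrite ltr_pdivlMr// in hd.
  have := normr_ge0 h; have := normr_ge0 c => pc ph; nra.
rewrite mulrA in hc.
have := Hd _ _ ch hc; rewrite ltr_pdivlMr// => Hf.
apply: le_lt_trans Hf; rewrite mulrC; apply: ler_wpM2l => //.
by rewrite lerDl.
Unshelve. all: by end_near. Qed.

Lemma box_compact (lo hi : 'I_n -> R) :
  compact [set x : V | forall i, lo i <= x 0 i <= hi i].
Proof.
have := @rV_compact _ _ (fun i => `[lo i, hi i]%classic).
move=> /(_ (fun i => @segment_compact _ _ _)); congr compact.
Qed.

End Directional.

Section Derivations.
Context {R : realType} {n : nat}.
Local Notation V := 'rV[R]_n.
Local Notation S := (smf R n).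
Implicit Types F G : S.

Lemma smf_smooth F : smooth F.
Proof. by case: F => f fS; exact/smooth_predP. Qed.

Lemma smf_ext F G : (forall x, F x = G x) -> F = G.
Proof. by move=> FG; apply/val_inj/funext. Qed.

Lemma smf_continuous F : continuous F.
Proof. exact/smooth_continuous/smf_smooth. Qed.

Lemma smf_sumE I (r : seq I) (P : pred I) (F : I -> S) x :
  (\sum_(i <- r | P i) F i) x = \sum_(i <- r | P i) F i x.
Proof. by elim/big_ind2 : _ => //= f a g b <- <-. Qed.

(** The locks keep simplification from exposing the underlying functions. *)
Definition pd (i : 'I_n) F : S :=
  locked (Smf (introT (smooth_predP _) (smooth_partial i (smf_smooth F)))).

Lemma pdE i F x : pd i F x = partial i F x.
Proof. by rewrite /pd -lock. Qed.

Lemma pd_is_derive i F x : is_derive x (delta_mx 0 i) F (pd i F x).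
Proof. by apply: DeriveDef; rewrite ?pdE//; exact/smooth_derivable/smf_smooth. Qed.

Fact smooth_cst (c : R) : smooth (cst c : V -> R).
Proof. by apply/smoothP => k; exact: Ck_cst. Qed.

Definition sconst (c : R) : S := locked (Smf (introT (smooth_predP _) (smooth_cst c))).

Fact smooth_coord j : smooth (fun y : V => y 0 j).
Proof. by apply/smoothP => k; exact: Ck_coord. Qed.

Definition scoord j : S := locked (Smf (introT (smooth_predP _) (smooth_coord j))).

Fact smooth_inv F : (forall x, F x != 0) -> smooth (fun x => (F x)^-1).
Proof.
move=> F0; apply/smoothP => k; apply: Ck_inv => //.
by have /smoothP := smf_smooth F; exact.
Qed.

Definition sinv F (F0 : forall x, F x != 0) : S :=
  locked (Smf (introT (smooth_predP _) (smooth_inv F0))).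

Lemma sconstE c x : sconst c x = c. Proof. by rewrite /sconst -lock. Qed.
Lemma scoordE j x : scoord j x = x 0 j. Proof. by rewrite /scoord -lock. Qed.
Lemma sinvE F (F0 : forall x, F x != 0) x : sinv F0 x = (F x)^-1.
Proof. by rewrite /sinv -lock. Qed.

Lemma smf_addE F G x : (F + G) x = F x + G x. Proof. by []. Qed.
Lemma smf_oppE F x : (- F) x = - F x. Proof. by []. Qed.
Lemma smf_mulE F G x : (F * G) x = F x * G x. Proof. by []. Qed.
Lemma smf_expE F k x : (F ^+ k) x = F x ^+ k.
Proof. by elim: k => // k IH; rewrite !exprS smf_mulE IH. Qed.
Lemma smf_natE k x : (k%:R : S) x = k%:R.
Proof. by elim: k => // k IH; rewrite !mulrS smf_addE IH. Qed.
Lemma smf_0E x : (0 : S) x = 0. Proof. by []. Qed.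
Lemma smf_1E x : (1 : S) x = 1. Proof. by []. Qed.

Lemma pd_sconst i c : pd i (sconst c) = 0.
Proof. by apply: smf_ext => x; rewrite pdE /partial /sconst -lock derive_cst. Qed.

Lemma pd_scoord i j : pd i (scoord j) = (i == j)%:R.
Proof.
apply: smf_ext => x; have [_] := partial_coord i j x.
by rewrite pdE /partial /scoord -lock => ->; case: (i == j).
Qed.

Let smf_derivable i F x : derivable F x (delta_mx 0 i).
Proof. exact/smooth_derivable/smf_smooth. Qed.

Lemma pd_add i F G : pd i (F + G) = pd i F + pd i G.
Proof.
apply: smf_ext => x; rewrite smf_addE !pdE.
exact: (deriveD (@smf_derivable i F x) (@smf_derivable i G x)).
Qed.

Lemma pd_opp i F : pd i (- F) = - pd i F.
Proof.
by apply: smf_ext => x; rewrite smf_oppE !pdE; exact: (deriveN (@smf_derivable i F x)).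
Qed.

Lemma pd_mul i F G : pd i (F * G) = F * pd i G + G * pd i F.
Proof.
apply: smf_ext => x; rewrite smf_addE !smf_mulE !pdE.
exact: (deriveM (@smf_derivable i F x) (@smf_derivable i G x)).
Qed.

HB.instance Definition _ i := GRing.isZmodMorphism.Build S S (pd i)
  (fun F G => etrans (pd_add i F (- G)) (congr1 _ (pd_opp i G))).

Definition smfE := (smf_sumE, smf_addE, smf_oppE, smf_mulE, smf_expE, smf_natE,
  smf_0E, smf_1E, sconstE, scoordE, sinvE).

Lemma pd_sub i F G : pd i (F - G) = pd i F - pd i G.
Proof. by rewrite pd_add pd_opp. Qed.

Lemma pd_1 i : pd i 1 = 0 :> S.
Proof. by rewrite -[RHS](pd_sconst i 1); congr pd; apply: smf_ext => x; rewrite !smfE. Qed.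

(** Defined as a combination of partial derivatives in order to be smooth by construction. *)
Definition dird (v : V) F : S := \sum_i sconst (v 0 i) * pd i F.

Lemma dird_is_derive v F x : is_derive x v F (dird v F x).
Proof.
have -> : v = \sum_i v 0 i *: delta_mx 0 i by rewrite -row_sum_delta.
have E : dird (\sum_i v 0 i *: delta_mx 0 i) F x = \sum_i v 0 i * pd i F x.
  by rewrite -row_sum_delta smf_sumE; apply: eq_bigr => i _; rewrite smf_mulE sconstE.
rewrite E; move: (index_enum _) => s; elim: s x {E} => [|i s IH] x.
  by rewrite !big_nil; exact: is_derive0.
rewrite !big_cons addrC [X in is_derive _ _ _ X]addrC.
apply: (@is_derive_addZ _ _ F (pd i F) (fun x => \sum_(j <- s) v 0 j * pd j F x)) => //.
- by move=> q; exact: pd_is_derive.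
- exact: smf_continuous.
Qed.

Lemma line_derive v F p (r : R) :
  is_derive r (1 : R) (fun s : R => F (p + s *: v)) (dird v F (p + r *: v)).
Proof. by apply: line_is_derive => q; exact: dird_is_derive. Qed.

Lemma dird_delta i F : dird (delta_mx 0 i) F = pd i F.
Proof.
rewrite /dird (bigD1 i)//= big1 ?addr0 => [|j ji].
  by apply: smf_ext => x; rewrite !smfE mxE !eqxx mul1r.
by apply: smf_ext => x; rewrite !smfE mxE (negPf ji) andbF mul0r.
Qed.

Lemma line_derive_delta i F p (r : R) :
  is_derive r (1 : R) (fun s : R => F (p + s *: delta_mx 0 i))
    (pd i F (p + r *: delta_mx 0 i)).
Proof. by have := line_derive (delta_mx 0 i) F p r; rewrite dird_delta. Qed.

(** The second difference is symmetric in [i] and [j], and two applications of the mean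
    value theorem identify it with a value of either mixed derivative near [p]. *)
Let diff2 i j F p (k : R) := F (p + k *: delta_mx 0 i + k *: delta_mx 0 j)
  - F (p + k *: delta_mx 0 i) - F (p + k *: delta_mx 0 j) + F p.

Let diff2_mean i j F p (k : R) : 0 < k -> exists a b,
  [/\ 0 < a < k, 0 < b < k &
   diff2 i j F p k = k ^+ 2 * pd j (pd i F) (p + a *: delta_mx 0 i + b *: delta_mx 0 j)].
Proof.
move=> k0; pose ei : V := delta_mx 0 i; pose ej : V := delta_mx 0 j.
have dq (r : R) : is_derive r (1 : R)
    ((fun s : R => F (p + k *: ej + s *: ei)) - (fun s : R => F (p + s *: ei)))
    (pd i F (p + k *: ej + r *: ei) - pd i F (p + r *: ei)).
  by apply: is_deriveB; exact: line_derive_delta.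
have [a ak /=] := MVT_everywhere k0 dq.
have dq' (r : R) : is_derive r (1 : R) (fun s : R => pd i F (p + a *: ei + s *: ej))
    (pd j (pd i F) (p + a *: ei + r *: ej)) by exact: line_derive_delta.
have [b bk /=] := MVT_everywhere k0 dq'.
rewrite !fctE !scale0r !addr0 !subr0 => E2 E1; exists a, b; split=> //.
rewrite expr2 -mulrA [k * pd _ _ _]mulrC -E2 mulrC.
rewrite [p + a *: ei + _]addrAC -E1 /diff2 -/ei -/ej.
by rewrite [p + k *: ej + _]addrAC opprB addrA addrAC.
Qed.

Lemma clairaut i j F : pd i (pd j F) = pd j (pd i F).
Proof.
apply: smf_ext => p; apply/eqP/negPn/negP; rewrite -subr_eq0 -normr_gt0 => e0.
set e := `|_| in e0.
have e2 : 0 < e / 2 by rewrite divr_gt0.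
have [d d0 Hd] := continuous_near_line (delta_mx 0 j) (delta_mx 0 i)
  (@smf_continuous (pd i (pd j F)) p) e2.
have [d' d'0 Hd'] := continuous_near_line (delta_mx 0 i) (delta_mx 0 j)
  (@smf_continuous (pd j (pd i F)) p) e2.
pose k := Num.min d d'.
have k0 : 0 < k by rewrite lt_min d0.
have [a [b [/andP[a0 ak] /andP[b0 bk] E]]] := diff2_mean j i F p k0.
have [a' [b' [/andP[a'0 a'k] /andP[b'0 b'k] E']]] := diff2_mean i j F p k0.
have sym : diff2 j i F p k = diff2 i j F p k.
  by rewrite /diff2 [_ + _ *: delta_mx 0 j + _]addrAC; ring.
move: ak bk a'k b'k; rewrite !lt_min => /andP[a1 a2] /andP[b1 b2] /andP[c1 c2] /andP[f1 f2].
have := Hd a b; rewrite (gtr0_norm a0) (gtr0_norm b0) => /(_ a1 b1) h2.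
have := Hd' a' b'; rewrite (gtr0_norm a'0) (gtr0_norm b'0) => /(_ c2 f2) h1.
have k20 : k ^+ 2 != 0 by rewrite expf_neq0// gt_eqF.
have := E; rewrite sym E' => /(mulfI k20) E3.
rewrite E3 in h1; rewrite distrC in h2.
have : e < e / 2 + e / 2.
  by apply: le_lt_trans (ltrD h2 h1); exact: ler_distD.
by rewrite -splitr ltxx.
Qed.

(** If [g2 0] were positive, [g1] would be positive to the right of [0] and [g] would
    exceed [g 0] there. *)
Lemma max_test1 (g g1 g2 : R -> R) (e : R) :
  (forall r, is_derive r (1 : R) g (g1 r)) -> (forall r, is_derive r (1 : R) g1 (g2 r)) ->
  continuous g2 -> 0 < e -> (forall r, `|r| < e -> g r <= g 0) ->
  g1 0 = 0 /\ g2 0 <= 0.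
Proof.
move=> dg dg1 cg2 e0 gmax.
have g10 : g1 0 = 0.
  have : is_derive (0 : R) (1 : R) g 0.
    apply: (@derive1_at_max _ _ (- e) e); rewrite ?in_itv/= ?oppr_lt0 ?e0//; try lra.
    by move=> t; rewrite in_itv -ltr_norml; exact: gmax.
  by move=> [_ v0]; have [_ v1] := dg 0; rewrite -v1 v0.
split=> //; rewrite leNgt; apply/negP => g20.
have /nbhs_normP[/= d d0 Hd] : \forall r \near (0 : R), 0 < g2 r.
  by have := cg2 0; move=> /cvgr_gt; exact.
pose r := Num.min d e / 2.
have m0 : 0 < Num.min d e by rewrite lt_min d0.
have r0 : 0 < r by rewrite divr_gt0.
have [rd re] : r < d /\ r < e.
  have /andP[] : (r < d) && (r < e) by rewrite -lt_min /r; lra.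
  by [].
have [c /andP[c0 cr] E] := MVT_everywhere r0 dg.
have [c' /andP[c'0 c'c] E'] := MVT_everywhere c0 dg1.
have g2c : 0 < g2 c'.
  by apply: Hd => /=; rewrite sub0r normrN gtr0_norm// (lt_trans c'c)// (lt_trans cr).
have := gmax r; rewrite gtr0_norm// => /(_ re).
rewrite g10 !subr0 in E E'.
have g1c : 0 < g1 c by rewrite E' mulr_gt0.
rewrite leNgt => /negP; apply; rewrite -subr_gt0 E mulr_gt0//.
Qed.

Lemma max_test F (p v : V) :
  (\forall q \near p, F q <= F p) -> dird v F p = 0 /\ dird v (dird v F) p <= 0.
Proof.
move=> /nbhs_normP[/= d d0 Hd].
have N0 : 0 < `|v| + 1 by rewrite ltr_wpDl.
have := @max_test1 (fun s => F (p + s *: v)) (fun s => dird v F (p + s *: v))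
  (fun s => dird v (dird v F) (p + s *: v)) (d / (`|v| + 1)).
rewrite scale0r addr0; apply.
- exact: line_derive.
- exact: line_derive.
- move=> r; apply/differentiable_continuous/derivable1_diffP.
  by have [] := line_derive v (dird v (dird v F)) p r.
- exact: divr_gt0.
- move=> r hr; apply: Hd => /=; rewrite opprD addrA subrr add0r normrN normrZ.
  rewrite ltr_pdivlMr// in hr; have := normr_ge0 v; have := normr_ge0 r; nra.
Qed.

End Derivations.

(** * Convexity *)

Section Convex.
Context {R : realType} {n : nat}.
Local Notation V := 'rV[R]_n.
Local Notation S := (smf R n).
Implicit Types F G : S.

Lemma dird_addZ (a : R) (v w : V) F : dird (a *: v + w) F = sconst a * dird v F + dird w F.
Proof.
apply: smf_ext => x; rewrite /dird !smfE mulr_sumr -big_split/=.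
by apply: eq_bigr => i _; rewrite !smfE !mxE mulrDl mulrA.
Qed.

Lemma dird_Z (a : R) (v : V) F : dird (a *: v) F = sconst a * dird v F.
Proof.
rewrite -[a *: v]addr0 dird_addZ; have -> : dird (0 : V) F = 0; last by rewrite addr0.
by rewrite /dird big1 // => i _; apply: smf_ext => x; rewrite !smfE mxE mul0r.
Qed.

Context (u : S) (u_convex : convex_function (E := V) [set: V] u).

Lemma convex_segment (p w : V) (r : R) : 0 <= r -> r <= 1 ->
  u (p + r *: w) <= u p + r * (u (p + w) - u p).
Proof.
move=> r0 r1; have := u_convex (Itv01 r0 r1) (in_setT (p + w)) (in_setT p).
have -> : conv (Itv01 r0 r1) (p + w : convex_lmodType V) p = p + r *: w.
  rewrite /conv/= scalerDr /unstable.onem scalerBl scale1r addrC addrA.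
  by rewrite subrK.
move/le_trans; apply; rewrite convRE /= /unstable.onem; lra.
Qed.

Lemma convex_gradient (p w : V) : dird w u p <= u (p + w) - u p.
Proof.
have [ex val] := dird_is_derive w u p.
rewrite leNgt; apply/negP => lt0; rewrite -val in lt0.
have /cvg_dnbhs_at_right/cvgr_gt/(_ _ lt0) H : (fun h : R => h^-1 *:
  (((u : V -> R) \o shift p) (h *: w) - u p)) @ 0^' --> 'D_w u p by exact: ex.
near (0 : R)^'+ => r.
have r0 : 0 < r by [].
have r1 : r <= 1 by near: r; exact: nbhs_right_le.
have : u (p + w) - u p < r^-1 *: (u (r *: w + p) - u p) by near: r.
apply/negP; rewrite -leNgt /GRing.scale /= mulrC ler_pdivrMr//.
have := convex_segment p w (ltW r0) r1; rewrite [r *: w + p]addrC.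
lra.
Unshelve. all: by end_near. Qed.

(** By the gradient inequality the function [r |-> u (p + r *: v)] minus its tangent has a
    minimum at [0]. *)
Lemma convex_hessian (p v : V) : 0 <= dird v (dird v u) p.
Proof.
pose a := dird v u p.
have := @max_test1 R (fun s : R => a * s - u (p + s *: v))
  (fun s => a - dird v u (p + s *: v))
  (fun s => - dird v (dird v u) (p + s *: v)) 1.
rewrite scale0r addr0 => H; rewrite -oppr_le0; apply H => //.
- move=> r; apply: is_deriveB; last exact: line_derive.
  have : is_derive r (1 : R) (a *: (id : R -> R)) (a *: (1 : R)) by exact: is_deriveZ.
  by rewrite [a *: 1]mulr1.
- move=> r; rewrite -[X in is_derive _ _ _ X]sub0r.
  by apply: is_deriveB; exact: line_derive.
- have c : continuous (fun s : R => dird v (dird v u) (p + s *: v)).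
    move=> r; apply/differentiable_continuous/derivable1_diffP.
    by have [] := line_derive v (dird v (dird v u)) p r.
  by move=> r; exact: (cvgN (c r)).
- move=> r _; have := convex_gradient p (r *: v); rewrite dird_Z smf_mulE sconstE mulr0.
  rewrite /a; lra.
Qed.

Lemma convex_D2_ge0 i p : 0 <= pd i (pd i u) p.
Proof. by have := convex_hessian p (delta_mx 0 i); rewrite !dird_delta. Qed.

End Convex.

(** * Functions with vanishing higher derivatives *)

Section ConstantDerivatives.
Context {R : realType} {n : nat}.
Local Notation V := 'rV[R]_n.
Local Notation S := (smf R n).
Implicit Types F G : S.

Lemma line_constant F (v p : V) (r : R) : dird v F = 0 -> F (p + r *: v) = F p.
Proof.
move=> dF; have E a b : a < b -> F (p + a *: v) = F (p + b *: v).
  move=> ab; have [c _ /eqP] := MVT_everywhere ab (line_derive v F p).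
  by rewrite dF smf_0E mul0r subr_eq0 => /eqP.
have -> : F p = F (p + 0 *: v) by rewrite scale0r addr0.
by have [lt|lt|->] := ltgtP r 0; [exact: E|rewrite (E _ _ lt)|].
Qed.

Lemma pd0_constant F x : (forall i, pd i F = 0) -> F x = F 0.
Proof.
move=> dF; have dird0 : dird x F = 0 by rewrite /dird big1// => i _; rewrite dF mulr0.
by have := line_constant 0 1 dird0; rewrite scale1r add0r.
Qed.

Lemma smf_mulI F G : (forall x, F x != 0) -> F * G = 0 -> G = 0.
Proof.
move=> F0 FG; apply: smf_ext => x.
have : F x * G x = 0 by rewrite -smf_mulE FG.
by move/eqP; rewrite mulf_eq0 (negPf (F0 x)) => /eqP.
Qed.

Lemma pd_double (i : 'I_n) F : pd i (2 * F) = 2 * pd i F.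
Proof.
have -> : 2 = sconst 2 :> S by apply: smf_ext => x; rewrite smf_natE sconstE.
by rewrite pd_mul pd_sconst mulr0 addr0.
Qed.

(** Along the [i]-th coordinate lines the function is affine and bounded below. *)
Lemma ge0_affine i F : (forall x, 0 <= F x) -> pd i (pd i F) = 0 -> pd i F = 0.
Proof.
move=> F0 DDF; apply: smf_ext => x.
have aff r : F (x + r *: delta_mx 0 i) = F x + r * pd i F x.
  have dG : dird (delta_mx 0 i) (F - scoord i * pd i F) = 0.
    by rewrite dird_delta pd_sub pd_mul DDF pd_scoord eqxx /=; ring.
  have dD : dird (delta_mx 0 i) (pd i F) = 0 by rewrite dird_delta.
  have := line_constant x r dG; rewrite !(smf_addE, smf_oppE, smf_mulE, scoordE).
  rewrite (line_constant x r dD) !mxE !eqxx /=; lra.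
apply/eqP; apply: contraT => c0.
have := F0 (x + (- (F x + 1) / pd i F x) *: delta_mx 0 i).
rewrite aff divfK//; lra.
Qed.

Lemma third_derivatives0_quadratic F :
  (forall i j k, pd i (pd j (pd k F)) = 0) -> quadratic F.
Proof.
move=> D3; pose A i j : R := pd i (pd j F) 0.
have DD i j : pd i (pd j F) = sconst (A i j).
  by apply: smf_ext => x; rewrite sconstE (@pd0_constant (pd i (pd j F)) x).
pose b i : R := pd i F 0.
have D1 i x : pd i F x = b i + \sum_j A i j * x 0 j.
  (* the gradient is affine because its derivatives are constant *)
  pose G : S := pd i F - \sum_j sconst (A i j) * scoord j.
  have GE x' : G x' = pd i F x' - \sum_j A i j * x' 0 j.
    rewrite /G smf_addE smf_oppE smf_sumE; congr (_ - _).
    by apply: eq_bigr => j _; rewrite !smfE.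
  have dG l : pd l G = 0.
    rewrite /G pd_sub raddf_sum (bigD1 l)//= big1 => [|j jl].
      rewrite clairaut DD pd_mul pd_sconst pd_scoord eqxx /= mulr0 addr0 addr0 mulr1.
      exact: subrr.
    by rewrite pd_mul pd_sconst pd_scoord eq_sym (negPf jl) /= !mulr0 addr0.
  have := pd0_constant x dG; rewrite !GE.
  rewrite [X in _ = _ - X]big1 => [|j _]; last by rewrite mxE mulr0.
  rewrite /b; lra.
(* Euler: half of [x . (grad F x + grad F 0)] recovers [F] up to a constant *)
pose H : S := F - sconst 2^-1 * \sum_i scoord i * (pd i F + sconst (b i)).
have HE x : H x = F x - 2^-1 * \sum_i x 0 i * (pd i F x + b i).
  rewrite /H smf_addE smf_oppE smf_mulE smf_sumE sconstE; congr (_ - _ * _).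
  by apply: eq_bigr => i _; rewrite !(smf_addE, smf_mulE, scoordE, sconstE).
have dH l : pd l H = 0.
  rewrite /H pd_sub pd_mul pd_sconst mulr0 addr0 raddf_sum /=.
  have -> : \sum_i pd l (scoord i * (pd i F + sconst (b i))) =
      pd l F + sconst (b l) + \sum_i scoord i * sconst (A l i).
    transitivity (\sum_i ((l == i)%:R * (pd i F + sconst (b i)) + scoord i * sconst (A l i))).
      apply: eq_bigr => i _; rewrite pd_mul pd_add pd_sconst addr0 DD pd_scoord; ring.
    rewrite big_split (bigD1 l)//= eqxx mul1r big1 ?addr0// => i il.
    by rewrite eq_sym (negPf il) mul0r.
  apply: smf_ext => x; rewrite !(smf_addE, smf_oppE, smf_mulE, sconstE) D1.
  have -> : (\sum_i scoord i * sconst (A l i)) x = \sum_j A l j * x 0 j.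
    by rewrite smf_sumE; apply: eq_bigr => i _; rewrite !smfE mulrC.
  by rewrite smf_0E; field.
exists (\matrix_(i, j) (2^-1 * A i j)), (\row_i b i), (F 0) => x.
have := pd0_constant x dH; rewrite !HE.
rewrite [X in _ = _ - _ * X]big1 => [|j _]; last by rewrite mxE mul0r.
rewrite mulr0 subr0 => /eqP; rewrite subr_eq => /eqP ->.
rewrite addrC; congr (_ + _).
rewrite mulr_sumr -big_split; apply: eq_bigr => i _ /=.
rewrite D1 mxE.
have -> : \sum_j (\matrix_(i0, j0) (2^-1 * A i0 j0)) i j * x 0 i * x 0 j =
    2^-1 * x 0 i * \sum_j A i j * x 0 j.
  by rewrite mulr_sumr; apply: eq_bigr => j _; rewrite mxE; ring.
by field.
Qed.

End ConstantDerivatives.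

(** * The pointwise inequality behind the gradient estimate *)

Section Algebra.
Context {R : realType}.

(** The Cauchy-Schwarz inequality on the diagonal. *)
Lemma sum_sqr_trace (n : nat) (M : 'I_n -> 'I_n -> R) : (0 < n)%N ->
  (\sum_i M i i) ^+ 2 <= n%:R * \sum_i \sum_j M i j ^+ 2.
Proof.
move=> n0.
have nR : 0 < n%:R :> R by rewrite ltr0n.
set T := \sum_i M i i.
have diag : \sum_i M i i ^+ 2 <= \sum_i \sum_j M i j ^+ 2.
  apply: ler_sum => i _; rewrite (bigD1 i)//= lerDl.
  by apply: sumr_ge0 => j _; exact: sqr_ge0.
apply: (le_trans _ (ler_wpM2l (ltW nR) diag)).
have : 0 <= \sum_i (n%:R * M i i - T) ^+ 2.
  by apply: sumr_ge0 => i _; exact: sqr_ge0.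
have -> : \sum_i (n%:R * M i i - T) ^+ 2 =
    n%:R * (n%:R * (\sum_i M i i ^+ 2) - T ^+ 2).
  transitivity (\sum_i (n%:R ^+ 2 * M i i ^+ 2 - 2 * n%:R * T * M i i + T ^+ 2)).
    by apply: eq_bigr => i _; ring.
  rewrite big_split/= big_split/= sumrN -!mulr_sumr -/T sumr_const card_ord -mulr_natl.
  ring.
by rewrite pmulr_rge0// subr_ge0.
Qed.

(** At an interior maximum point of [ph ^+ 2 * |grad F| ^+ 2 / F ^+ 2], with value [m],
    the function [ph ^+ 2 * |grad F| ^+ 2 - m * F ^+ 2] has a zero maximum, where
    [ph = r ^+ 2 - |y| ^+ 2] is the cutoff.  The hypotheses are the first and second
    order conditions at that point: [f], [fg], [H] stand for the value, gradient and
    Hessian of the harmonic function, [pg] for the gradient of [ph], [Pg] for the one of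
    [P = |grad F| ^+ 2], and [r2] for [|y| ^+ 2].

    Bounding the Hessian by Cauchy-Schwarz against the gradient only makes all terms in
    [m * P] cancel.  The gain [2 / n * m * P] comes from comparing the trace and the norm
    of [f * H - fg fg^T], which is [f ^+ 2] times the Hessian of [log F] ([trace]); the
    remaining cross term [z] is absorbed by completing a square ([young]). *)
Lemma gradient_bound_algebra (n : nat) (f ph m r2 : R) (fg pg Pg : 'I_n -> R)
    (H : 'I_n -> 'I_n -> R) :
  let P := \sum_c fg c ^+ 2 in
  (0 < n)%N -> 0 < f -> 0 < ph -> 0 < P ->
  \sum_c pg c ^+ 2 = 4 * r2 -> m * f ^+ 2 = ph ^+ 2 * P ->
  (forall c, Pg c = 2 * \sum_a fg a * H c a) ->
  (forall c, 2 * ph * pg c * P + ph ^+ 2 * Pg c - 2 * m * f * fg c = 0) ->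
  \sum_c H c c = 0 ->
  2 * ph ^+ 2 * (\sum_c \sum_a H c a ^+ 2) + P * (8 * r2 - 4 * n%:R * ph)
    + 4 * ph * (\sum_c pg c * Pg c) - 2 * m * P <= 0 ->
  m <= n%:R * (4 * n%:R * ph + (24 + 16 * n%:R) * r2).
Proof.
move=> P n0 f0 ph0 P0 Epg Em EPg E1 trH E2.
have nR : 0 < n%:R :> R by rewrite ltr0n.
set g := \sum_c pg c * fg c.
set A := \sum_c pg c * Pg c in E2.
set W := \sum_c \sum_a H c a ^+ 2 in E2.
pose B := \sum_c fg c * Pg c.
pose z := ph * g / f.
have fN : f != 0 by rewrite gt_eqF.
have phN : ph != 0 by rewrite gt_eqF.
have zE : z * f = ph * g by rewrite /z divfK.
have eA : 8 * ph * r2 * P + ph ^+ 2 * A - 2 * m * f * g = 0.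
  have : \sum_c pg c * (2 * ph * pg c * P + ph ^+ 2 * Pg c - 2 * m * f * fg c) = 0.
    by apply: big1 => c _; rewrite E1 mulr0.
  move=> <-.
  transitivity (\sum_c (2 * ph * P * pg c ^+ 2 + ph ^+ 2 * (pg c * Pg c) -
     2 * m * f * (pg c * fg c))); last by apply: eq_bigr => c _; ring.
  by rewrite big_split big_split/= sumrN -!mulr_sumr Epg -/g -/A; ring.
have eB : 2 * ph * g * P + ph ^+ 2 * B - 2 * m * f * P = 0.
  have : \sum_c fg c * (2 * ph * pg c * P + ph ^+ 2 * Pg c - 2 * m * f * fg c) = 0.
    by apply: big1 => c _; rewrite E1 mulr0.
  move=> <-.
  transitivity (\sum_c (2 * ph * P * (pg c * fg c) + ph ^+ 2 * (fg c * Pg c) -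
     2 * m * f * (fg c ^+ 2))); last by apply: eq_bigr => c _; ring.
  by rewrite big_split big_split/= sumrN -!mulr_sumr -/g -/B -/P; ring.
have trace : P ^+ 2 <= n%:R * (f ^+ 2 * W - f * B + P ^+ 2).
  have := sum_sqr_trace (fun c a => f * H c a - fg c * fg a) n0.
  have -> : \sum_c (f * H c c - fg c * fg c) = - P.
    rewrite big_split/= -mulr_sumr trH mulr0 add0r sumrN.
    by congr (- _); apply: eq_bigr => c _; rewrite expr2.
  rewrite sqrrN; move=> /le_trans; apply; rewrite ler_wpM2l ?(ltW nR)//.
  rewrite le_eqVlt; apply/orP; left; apply/eqP.
  transitivity (\sum_c (f ^+ 2 * (\sum_a H c a ^+ 2) - f * (fg c * Pg c) + P * fg c ^+ 2)).
    apply: eq_bigr => c _; rewrite EPg.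
    transitivity (\sum_a (f ^+ 2 * H c a ^+ 2 - (2 * f * fg c) * (fg a * H c a)
       + fg c ^+ 2 * fg a ^+ 2)); first by apply: eq_bigr => a _; ring.
    by rewrite big_split big_split/= sumrN -!mulr_sumr -/P; ring.
  by rewrite big_split big_split/= sumrN -!mulr_sumr -/P -/W -/B; ring.
have young : 0 <= 64 * n%:R ^+ 2 * r2 + 16 * n%:R * z + 4 * m.
  have : 0 <= \sum_c (4 * n%:R * f * pg c + 2 * ph * fg c) ^+ 2.
    by apply: sumr_ge0 => c _; exact: sqr_ge0.
  have -> : \sum_c (4 * n%:R * f * pg c + 2 * ph * fg c) ^+ 2 =
      f ^+ 2 * (64 * n%:R ^+ 2 * r2 + 16 * n%:R * z + 4 * m).
    transitivity (\sum_c (16 * n%:R ^+ 2 * f ^+ 2 * pg c ^+ 2 +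
       16 * n%:R * f * ph * (pg c * fg c) + 4 * ph ^+ 2 * fg c ^+ 2)).
      by apply: eq_bigr => c _; ring.
    rewrite big_split big_split/= -!mulr_sumr Epg -/g -/P.
    transitivity (16 * n%:R ^+ 2 * f ^+ 2 * (4 * r2) + 16 * n%:R * f * (ph * g)
       + 4 * (ph ^+ 2 * P)); first by ring.
    by rewrite -zE -Em; ring.
  by rewrite pmulr_rge0// exprn_gt0.
have phA : ph * A = 2 * P * z - 8 * r2 * P.
  apply: (mulfI phN); apply: (mulfI fN).
  have -> : f * (ph * (ph * A)) = f * (ph ^+ 2 * A) by ring.
  have -> : ph ^+ 2 * A = 2 * m * f * g - 8 * ph * r2 * P by lra.
  have -> : f * (2 * m * f * g - 8 * ph * r2 * P) =
     2 * (m * f ^+ 2) * g - 8 * f * ph * r2 * P by ring.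
  rewrite Em.
  have -> : 2 * (ph ^+ 2 * P) * g = 2 * ph * P * (ph * g) by ring.
  by rewrite -zE; ring.
have phB : ph ^+ 2 * B = 2 * f * P * (m - z).
  have -> : ph ^+ 2 * B = 2 * m * f * P - 2 * (ph * g) * P by lra.
  by rewrite -zE; ring.
have phW : m * P <= n%:R * (ph ^+ 2 * W + 2 * P * z - m * P).
  rewrite -(ler_pM2l (exprn_gt0 2 f0)).
  have -> : f ^+ 2 * (m * P) = ph ^+ 2 * P ^+ 2.
    by rewrite mulrA [f ^+ 2 * m]mulrC Em; ring.
  apply: (le_trans (ler_wpM2l (ltW (exprn_gt0 2 ph0)) trace)).
  have -> : ph ^+ 2 * (n%:R * (f ^+ 2 * W - f * B + P ^+ 2)) =
    n%:R * (f ^+ 2 * ph ^+ 2 * W - f * (ph ^+ 2 * B) + (ph ^+ 2 * P) * P) by ring.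
  by rewrite phB -Em le_eqVlt; apply/orP; left; apply/eqP; ring.
have E3 : n%:R * (2 * ph ^+ 2 * W + P * (8 * r2 - 4 * n%:R * ph)
    + 4 * (ph * A) - 2 * m * P) <= 0.
  by rewrite pmulr_rle0//; move: E2; rewrite mulrA.
rewrite phA in E3.
have : P * (2 * m + 4 * n%:R * z - 24 * n%:R * r2 - 4 * n%:R ^+ 2 * ph) <= 0.
  move: E3 phW; lra.
rewrite pmulr_rle0//; move: young; lra.
Qed.

End Algebra.

(** * The Legendre frame and its Laplacian *)

Section Frame.
Context {R : realType} {n : nat} (t : 'I_n) (u : smf R n).
Local Notation V := 'rV[R]_n.
Local Notation S := (smf R n).
Implicit Types F G : S.
Context (u_convex : convex_function (E := V) [set: V] u).
Context (u_eq : pd t (pd t u) * (\sum_(i < n | i != t) pd i (pd i u))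
  - \sum_(i < n | i != t) pd t (pd i u) ^+ 2 = 1).

Lemma utt_gt0 x : 0 < pd t (pd t u) x.
Proof.
rewrite lt_neqAle convex_D2_ge0// andbT eq_sym; apply/eqP => u0.
have := congr1 (fun F : S => F x) u_eq; rewrite !smfE u0 mul0r sub0r => E.
have : 0 <= \sum_(i < n | i != t) (pd t (pd i u) ^+ 2) x.
  by apply: sumr_ge0 => i _; rewrite smf_expE sqr_ge0.
lra.
Qed.

Lemma utt_neq0 x : pd t (pd t u) x != 0.
Proof. by rewrite gt_eqF// utt_gt0. Qed.

Definition inv_utt : S := sinv utt_neq0.

Lemma inv_utt_gt0 x : 0 < inv_utt x.
Proof. by rewrite sinvE invr_gt0 utt_gt0. Qed.

Lemma inv_utt_mul : inv_utt * pd t (pd t u) = 1.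
Proof. by apply: smf_ext => x; rewrite !smfE mulVf// utt_neq0. Qed.

Lemma pd_inv_utt i : pd i inv_utt = - (inv_utt * inv_utt * pd i (pd t (pd t u))).
Proof.
have := congr1 (pd i) inv_utt_mul; rewrite pd_mul pd_1 => E.
have : inv_utt * (inv_utt * pd i (pd t (pd t u)) + pd t (pd t u) * pd i inv_utt) = 0.
  by rewrite E mulr0.
have -> : inv_utt * (inv_utt * pd i (pd t (pd t u)) + pd t (pd t u) * pd i inv_utt) =
  inv_utt * inv_utt * pd i (pd t (pd t u)) + (inv_utt * pd t (pd t u)) * pd i inv_utt.
  by ring.
by rewrite inv_utt_mul mul1r addrC => /eqP; rewrite addr_eq0 => /eqP.
Qed.

(** The derivatives with respect to the coordinates [(u_t, x)], [u_t] taking the place of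
    [t]. *)
Definition leg_d (a : 'I_n) F : S :=
  if a == t then inv_utt * pd t F else pd a F - inv_utt * pd t (pd a u) * pd t F.

Lemma leg_dtE F : leg_d t F = inv_utt * pd t F.
Proof. by rewrite /leg_d eqxx. Qed.

Lemma leg_diE i F : i != t -> leg_d i F = pd i F - inv_utt * pd t (pd i u) * pd t F.
Proof. by rewrite /leg_d => /negPf ->. Qed.

Lemma leg_d_mul a F G : leg_d a (F * G) = F * leg_d a G + G * leg_d a F.
Proof. by rewrite /leg_d; case: eqP => _; rewrite !pd_mul; ring. Qed.

Lemma leg_d_sub a F G : leg_d a (F - G) = leg_d a F - leg_d a G.
Proof. by rewrite /leg_d; case: eqP => _; rewrite !pd_sub; ring. Qed.

HB.instance Definition _ a := GRing.isZmodMorphism.Build S S (leg_d a) (leg_d_sub a).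

Lemma leg_d_const a c : leg_d a (sconst c) = 0.
Proof. by rewrite /leg_d; case: eqP => _; rewrite !pd_sconst; ring. Qed.

(** The bracket vanishes since these are coordinate fields of [(u_t, x)]; in terms of [u]
    it reduces to the symmetry of third derivatives. *)
Lemma leg_d_comm a b F : leg_d a (leg_d b F) = leg_d b (leg_d a F).
Proof.
have comm_ti i : i != t -> leg_d t (leg_d i F) = leg_d i (leg_d t F).
  move=> it; rewrite !leg_dtE !leg_diE// !(pd_sub, pd_mul, pd_inv_utt).
  by rewrite (clairaut t i F) (clairaut i t (pd t u)) (clairaut i t u); ring.
have [->|at'] := eqVneq a t; have [->|bt'] := eqVneq b t => //; first exact: comm_ti.
  by rewrite comm_ti.
rewrite !leg_diE// !(pd_sub, pd_mul, pd_inv_utt).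
rewrite (clairaut b a F) (clairaut a t F) (clairaut b t F).
rewrite (clairaut a t (pd b u)) (clairaut b t (pd a u)) (clairaut b a u).
rewrite (clairaut a t (pd t u)) (clairaut b t (pd t u)) (clairaut a t u) (clairaut b t u).
ring.
Qed.

Definition leg_lap F : S := \sum_a leg_d a (leg_d a F).

Lemma leg_lap_d a F : leg_lap (leg_d a F) = leg_d a (leg_lap F).
Proof.
rewrite /leg_lap raddf_sum; apply: eq_bigr => b _ /=.
by rewrite (leg_d_comm b a F) (leg_d_comm b a).
Qed.

(** Up to sign this is the [t]-derivative of the Donaldson equation times [inv_utt ^+ 2]. *)
Lemma leg_lap_time : leg_lap (scoord t) = 0.
Proof.
rewrite /leg_lap (bigD1 t)//= leg_dtE leg_dtE pd_scoord eqxx mulr1 pd_inv_utt.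
have Xi i : i != t -> leg_d i (leg_d i (scoord t)) =
    - (inv_utt * pd t (pd i (pd i u))
       - 2 * inv_utt * inv_utt * (pd t (pd i u) * pd t (pd t (pd i u)))
       + inv_utt * inv_utt * inv_utt * pd t (pd t (pd t u)) * pd t (pd i u) ^+ 2).
  move=> it; rewrite !leg_diE// !pd_scoord eqxx (negPf it) !(pd_sub, pd_mul, pd_inv_utt).
  rewrite ?(raddf0, pd_1) (clairaut i t (pd i u)) (clairaut i t (pd t u)) (clairaut i t u).
  by rewrite /=; ring.
rewrite (eq_bigr _ Xi) sumrN !big_split/= sumrN -!mulr_sumr.
have Dsq : pd t (\sum_(i < n | i != t) pd t (pd i u) ^+ 2) =
    2 * \sum_(i < n | i != t) pd t (pd i u) * pd t (pd t (pd i u)).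
  rewrite raddf_sum mulr_sumr; apply: eq_bigr => i _ /=.
  by rewrite expr2 pd_mul; ring.
have := congr1 (pd t) u_eq; rewrite pd_1 pd_sub pd_mul Dsq raddf_sum /=.
have := u_eq.
set A := \sum_(i | _) pd i (pd i u); set B := \sum_(i | _) pd t (pd i u) ^+ 2.
set C := \sum_(i | _) pd t (pd i (pd i u)).
set E := \sum_(i | _) _ * _.
set w := pd t (pd t u); set w' := pd t w => e1 e2.
have hw : inv_utt * w = 1 by exact: inv_utt_mul.
set h := inv_utt in hw *.
have -> : h * (- (h * h * w')) - (h * C - 2 * h * h * E + h * h * h * w' * B) =
  - h * h * h * w' * (1 + B) - (h * w) * h * C + 2 * h * h * E
   by rewrite hw; ring.
have -> : 1 + B = w * A by rewrite -e1; ring.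
have -> : - h * h * h * w' * (w * A) - h * w * h * C + 2 * h * h * E =
   - (h * h) * ((h * w) * (w' * A) + w * C - (2 * E)) by ring.
rewrite hw mul1r.
have -> : w' * A + w * C - (2 * E) = w * C + A * w' - (2 * E) by ring.
by rewrite e2 mulr0.
Qed.

Lemma leg_lap_inv_utt : leg_lap inv_utt = 0.
Proof.
have -> : inv_utt = leg_d t (scoord t).
  by rewrite leg_dtE pd_scoord eqxx mulr1.
by rewrite leg_lap_d leg_lap_time raddf0.
Qed.

(** At a critical point the second derivative along a field depends only on the value of
    the field there, so the test along a straight line applies. *)
Lemma leg_d_max_test F p : (\forall q \near p, F q <= F p) ->
  forall a, leg_d a F p = 0 /\ leg_d a (leg_d a F) p <= 0.
Proof.
move=> Fmax a.
have [Ft Ftt] : pd t F p = 0 /\ pd t (pd t F) p <= 0.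
  by have := max_test (delta_mx 0 t) Fmax; rewrite !dird_delta.
have [->|at'] := eqVneq a t.
  rewrite !leg_dtE pd_mul !smfE Ft !mulr0 mul0r addr0; split=> //.
  by have := inv_utt_gt0 p; nra.
pose c := (inv_utt * pd t (pd a u)) p.
have dirdE G : dird (- c *: delta_mx 0 t + delta_mx 0 a) G = sconst (- c) * pd t G + pd a G.
  by rewrite dird_addZ !dird_delta.
have := max_test (- c *: delta_mx 0 t + delta_mx 0 a) Fmax.
rewrite !dirdE !(pd_add, pd_mul) !pd_sconst !smfE Ft => -[e1 e2].
rewrite !leg_diE// !(pd_sub, pd_mul, pd_inv_utt) !smfE Ft; split.
  by move: e1; rewrite /c !smfE; lra.
rewrite (clairaut a t F) in e2 *.
move: e2; rewrite /c !smfE; lra.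
Qed.

(** The coordinates dual to the frame. *)
Definition leg_coord (a : 'I_n) : S := if a == t then pd t u else scoord a.

Lemma leg_d_coord a b : leg_d a (leg_coord b) = (a == b)%:R.
Proof.
rewrite /leg_coord; have [->|bt'] := eqVneq b t.
  have [->|at'] := eqVneq a t; first by rewrite leg_dtE inv_utt_mul.
  rewrite leg_diE// (clairaut a t u) -mulrA [_ * pd t (pd t u)]mulrC mulrA inv_utt_mul.
  by rewrite mul1r subrr.
have [->|at'] := eqVneq a t.
  by rewrite leg_dtE pd_scoord eq_sym (negPf bt') mulr0.
by rewrite leg_diE// !pd_scoord (eq_sym t) (negPf bt') mulr0 subr0.
Qed.

Lemma leg_lap_mul F G : leg_lap (F * G) =
  F * leg_lap G + G * leg_lap F + 2 * \sum_a leg_d a F * leg_d a G.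
Proof.
rewrite /leg_lap !mulr_sumr -!big_split; apply: eq_bigr => a _ /=.
by rewrite !(leg_d_mul, raddfD)/= !leg_d_mul; ring.
Qed.

Lemma leg_lap_sub F G : leg_lap (F - G) = leg_lap F - leg_lap G.
Proof.
by rewrite /leg_lap -sumrB; apply: eq_bigr => a _; rewrite !leg_d_sub.
Qed.

Lemma leg_lap_const c : leg_lap (sconst c) = 0.
Proof. by rewrite /leg_lap big1// => a _; rewrite leg_d_const raddf0. Qed.

Lemma leg_lap_max_test F p : (\forall q \near p, F q <= F p) -> leg_lap F p <= 0.
Proof.
move=> Fmax; rewrite /leg_lap smf_sumE.
by apply: sumr_le0 => a _; have [] := leg_d_max_test Fmax a.
Qed.

Lemma leg_lap_add F G : leg_lap (F + G) = leg_lap F + leg_lap G.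
Proof.
by rewrite /leg_lap -big_split; apply: eq_bigr => a _ /=; rewrite !raddfD.
Qed.

Lemma leg_lap_constM c F : leg_lap (sconst c * F) = sconst c * leg_lap F.
Proof.
rewrite leg_lap_mul leg_lap_const mulr0 addr0 big1 => [|a _]; last by rewrite leg_d_const mul0r.
by rewrite mulr0 addr0.
Qed.

Lemma smf_const1 : 1 = sconst 1 :> S.
Proof. by apply: smf_ext => x; rewrite !smfE. Qed.

Lemma leg_lap_coord i : leg_lap (leg_coord i) = 0.
Proof.
rewrite /leg_lap big1// => a _; rewrite leg_d_coord.
by case: (a == i); rewrite ?raddf0// [true%:R]smf_const1 leg_d_const.
Qed.

Lemma leg_lap_coord_sqr i : leg_lap (leg_coord i ^+ 2) = 2.
Proof.
rewrite expr2 leg_lap_mul leg_lap_coord mulr0 !add0r (bigD1 i)//= leg_d_coord eqxx big1 => [|a ai].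
  by rewrite addr0 !mulr1.
by rewrite leg_d_coord (negPf ai) mul0r.
Qed.

(** * Unboundedness of the time slope and compactness of balls *)

Definition flat (x : V) : V := x - x 0 t *: delta_mx 0 t.

Lemma flat_t (x : V) : flat x 0 t = 0.
Proof. by rewrite /flat !mxE !eqxx mulr1 subrr. Qed.

Lemma flat_i (x : V) i : i != t -> flat x 0 i = x 0 i.
Proof. by move=> it; rewrite /flat !mxE (negPf it) andbF mulr0 subr0. Qed.

Lemma gradient_time (x : V) (r : R) : r * pd t u x <= u (x + r *: delta_mx 0 t) - u x.
Proof.
have := convex_gradient u_convex x (r *: delta_mx 0 t).
by rewrite dird_Z dird_delta smf_mulE sconstE.
Qed.

Lemma flat_lower (x : V) : u x - u (flat x) <= x 0 t * pd t u x.
Proof.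
by have := gradient_time x (- x 0 t); rewrite scaleNr -/(flat x); lra.
Qed.

Lemma flat_upper (x : V) : x 0 t * pd t u (flat x) <= u x - u (flat x).
Proof.
by have := gradient_time (flat x) (x 0 t); rewrite /flat subrK.
Qed.

(** The sign [s] treats the behaviour of [u_t] for [t] tending to either infinity at
    once. *)
Section Slope.
Context (s : R) (s1 : s = 1 \/ s = -1).

Let s2 : s * s = 1.
Proof. by case: s1 => ->; rewrite ?mulrNN mulr1. Qed.

Let sK (a : R) : a = s * (s * a).
Proof. by rewrite mulrA s2 mul1r. Qed.

Lemma slope_mono (x : V) : 0 <= s * x 0 t -> s * pd t u (flat x) <= s * pd t u x.
Proof.
rewrite le_eqVlt => /orP[/eqP x0|x0].
  have x00 : x 0 t = 0 by rewrite (sK (x 0 t)) -x0 mulr0.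
  by rewrite /flat x00 scale0r subr0.
have := le_trans (flat_upper x) (flat_lower x).
have e a : x 0 t * a = s * x 0 t * (s * a) by rewrite mulrACA s2 mul1r.
by rewrite !e ler_pM2l.
Qed.

(** The tangent plane at [p0] bounds [u] below by [t * u_t p0 - C], uniformly over a
    bounded set of [x]; convexity in [t] turns this growth of [u] into a lower bound for
    [u_t].  In particular the supremum of [s * u_t] is the same on all vertical lines. *)
Lemma uniform_growth (p0 : V) (b : R) : b < s * pd t u p0 ->
  forall (x0 : V) (r : R), 0 <= r -> exists2 T, 0 < T & forall x : V,
    (forall i, i != t -> `|x 0 i - x0 0 i| <= r) -> T <= s * x 0 t -> b < s * pd t u x.
Proof.
move=> hb x0 r r0.
pose Phi : S := sconst (u p0) - u + \sum_i (scoord i - sconst (p0 0 i)) * sconst (pd i u p0).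
pose B := [set x : V | forall i,
   (if i == t then 0 else x0 0 i - r) <= x 0 i <= (if i == t then 0 else x0 0 i + r)].
have B0 : B !=set0.
  by exists (flat x0) => i; case: eqP => [->|/eqP it]; rewrite ?flat_t ?flat_i ?lexx//; lra.
have [q _ qmin] := EVT_min_rV B0 (@box_compact _ _ _ _)
  (continuous_subspaceT (@smf_continuous _ _ Phi)).
have PhiE z : Phi z = u p0 - u z + dird (z - p0) u p0.
  rewrite /Phi /dird !smfE; congr (_ + _); apply: eq_bigr => i _.
  by rewrite !smfE !mxE.
pose C := Num.max 0 (- Phi q).
have C0 : 0 <= C by rewrite le_max lexx.
have d0 : 0 < s * pd t u p0 - b by rewrite subr_gt0.
exists (C / (s * pd t u p0 - b) + 1); first by rewrite ltr_wpDl// divr_ge0// ltW.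
move=> x xB xT.
have fB : flat x \in B.
  rewrite inE => i; case: eqP => [->|/eqP it]; first by rewrite flat_t lexx.
  by rewrite flat_i//; have := xB i it; rewrite ler_norml; lra.
have := qmin _ fB; rewrite [Phi (flat x)]PhiE => lowPhi.
have lowC : - C <= Phi q by rewrite lerNl le_max lexx orbT.
have dec : dird (x - p0) u p0 = dird (flat x - p0) u p0 + x 0 t * pd t u p0.
  have -> : x - p0 = x 0 t *: delta_mx 0 t + (flat x - p0).
    by rewrite /flat addrA [_ *: _ + _]addrC subrK.
  by rewrite dird_addZ smf_addE smf_mulE sconstE dird_delta addrC.
have g1 := convex_gradient u_convex p0 (x - p0).
rewrite dec [p0 + _]addrC subrK in g1.
have g2 := flat_lower x.
have key : s * x 0 t * (s * pd t u p0) - C <= s * x 0 t * (s * pd t u x).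
  have e a : s * x 0 t * (s * a) = x 0 t * a by rewrite mulrACA s2 mul1r.
  rewrite !e; lra.
have T0 : 0 < s * x 0 t.
  by apply: lt_le_trans xT; rewrite ltr_wpDl// divr_ge0// ltW.
rewrite -(ltr_pM2l T0); apply: lt_le_trans key.
have : C < s * x 0 t * (s * pd t u p0 - b).
  apply: (@lt_le_trans _ _ ((C / (s * pd t u p0 - b) + 1) * (s * pd t u p0 - b))).
    by rewrite mulrDl divfK ?gt_eqF// mul1r ltrDl.
  by rewrite ler_pM2r.
lra.
Qed.

(** Suppose that [s * u_t] has a finite supremum [be], and let [tau = be - s * u_t > 0].
    In the coordinates [(tau, x)] the function [w = n tau^2 - |x|^2 + 1 - C tau] is
    strictly subharmonic and, for a suitable [C], at most [0] where [s t = 0] and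
    where [|x| = 1], and at most [1] throughout.  As [s t] is harmonic, nonnegative
    on [0 <= s t <= T] and equal to [T] on the top, the maximum principle gives
    [s t >= T w] in the region.  At a fixed point where [w > 1/2] this fails for
    large [T]. *)
Lemma slope_unbounded (b : R) : exists p, b < s * pd t u p.
Proof.
apply: contrapT => nb.
have {nb}bd x : s * pd t u x <= b.
  by rewrite leNgt; apply/negP => lt; apply: nb; exists x.
pose E := [set s * pd t u x | x in [set: V]].
have E0 : E !=set0 by exists (s * pd t u 0), 0.
have Eub : has_ubound E by exists b => _ [x _ <-].
pose be := sup E.
have leb x : s * pd t u x <= be by apply: ub_le_sup => //; exists x.
pose tau : S := sconst be - sconst s * pd t u.
have tauE x : tau x = be - s * pd t u x by rewrite /tau !smfE.
have tau0 x : 0 < tau x.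
  rewrite tauE subr_gt0 lt_neqAle leb andbT; apply/eqP => eb.
  have := @max_test _ _ (sconst s * pd t u) x (delta_mx 0 t).
  have : \forall q \near x, (sconst s * pd t u) q <= (sconst s * pd t u) x.
    by apply: filterE => q; rewrite !smf_mulE !sconstE eb.
  move=> /[swap] /[apply] -[+ _]; rewrite dird_delta pd_mul pd_sconst mulr0 addr0 smf_mulE sconstE.
  move/eqP; rewrite mulf_eq0 (negPf (utt_neq0 x)) orbF => /eqP s0.
  by move: s2; rewrite s0 mul0r => /eqP; rewrite eq_sym oner_eq0.
pose B := [set x : V | forall i,
   (if i == t then 0 else -1) <= x 0 i <= (if i == t then 0 else 1)].
have B0 : B !=set0 by exists 0 => i; rewrite mxE; case: eqP; rewrite ?lexx// lerN10 ler01.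
have [q _ qmin] := EVT_min_rV B0 (@box_compact _ _ _ _)
  (continuous_subspaceT (@smf_continuous _ _ tau)).
have [q' _ qmax] := EVT_max_rV B0 (@box_compact _ _ _ _)
  (continuous_subspaceT (@smf_continuous _ _ tau)).
set d := tau q in qmin; set d' := tau q' in qmax.
have d0 : 0 < d by exact: tau0.
have d'0 : 0 < d' by exact: tau0.
have n0 : (0 < n)%N by case: (n) t => // -[].
pose N : R := n%:R.
have N0 : 0 < N by rewrite ltr0n.
(* [d] and [d'] bound [tau] on the bottom [s t = 0] of the region; with this [C] the
   function [N tau^2 + 1 - C tau] is nonpositive for [d <= tau <= d'], and
   [N tau^2 <= C tau] for all [tau <= d']. *)
pose C := N * d' + d^-1.
have C0 : 0 < C by rewrite addr_gt0 ?mulr_gt0 ?invr_gt0.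
pose r2 : S := \sum_(i | i != t) scoord i ^+ 2.
pose w : S := sconst N * tau ^+ 2 - r2 + 1 - sconst C * tau.
have r2E x : r2 x = \sum_(i | i != t) x 0 i ^+ 2.
  by rewrite /r2 smf_sumE; apply: eq_bigr => i _; rewrite !smfE.
have wE x : w x = N * tau x ^+ 2 - r2 x + 1 - C * tau x.
  by rewrite /w !(smf_addE, smf_oppE, smf_mulE, smf_expE, sconstE).
have tauY : tau = sconst be - sconst s * leg_coord t by rewrite /leg_coord eqxx.
have Ltau : leg_lap tau = 0.
  by rewrite tauY leg_lap_sub leg_lap_const leg_lap_constM leg_lap_coord mulr0 subr0.
have Ltau2 : leg_lap (tau ^+ 2) = 2.
  have Xtau a : leg_d a tau = - (sconst s * (a == t)%:R).
    by rewrite tauY leg_d_sub leg_d_const sub0r leg_d_mul leg_d_const mulr0 addr0 leg_d_coord.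
  rewrite expr2 leg_lap_mul Ltau mulr0 !add0r (bigD1 t)//= Xtau eqxx big1 => [|a ta].
    rewrite addr0; apply: smf_ext => x; rewrite !smfE mulr1 mulrNN s2; ring.
  by rewrite Xtau (negPf ta) mulr0 oppr0 mul0r.
have Lr2 : leg_lap r2 + 2 = sconst N * 2.
  have -> : leg_lap r2 = \sum_(i | i != t) 2.
    have -> : leg_lap r2 = \sum_(i | i != t) leg_lap (scoord i ^+ 2).
      rewrite /leg_lap exchange_big; apply: eq_bigr => c _ /=.
      by rewrite /r2 !raddf_sum.
    apply: eq_bigr => i it.
    have -> : scoord i = leg_coord i by rewrite /leg_coord (negPf it).
    exact: leg_lap_coord_sqr.
  transitivity (\sum_(i < n) (2 : S)); first by rewrite [RHS](bigD1 t)//= addrC.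
  rewrite sumr_const card_ord; apply: smf_ext => x.
  by rewrite -[2 *+ n]mulr_natr !smfE mulrC.
have Lw : leg_lap w = 2.
  rewrite /w leg_lap_sub leg_lap_add leg_lap_sub !leg_lap_constM Ltau Ltau2 -Lr2.
  by rewrite smf_const1 leg_lap_const; ring.
have [p1 hp1] : exists p1, be - (2 * C)^-1 < s * pd t u p1.
  have e0 : 0 < (2 * C)^-1 by rewrite invr_gt0 mulr_gt0.
  have [_ [x _ <-] hx] := sup_adherent e0 (conj E0 Eub).
  by exists x.
have [T0 T00 HT0] := uniform_growth hp1 0 ler01.
pose p2 : V := (s * T0) *: delta_mx 0 t.
have p2i i : i != t -> p2 0 i = 0 by move=> it; rewrite !mxE (negPf it) andbF mulr0.
have p2t : s * p2 0 t = T0 by rewrite !mxE !eqxx mulr1 -sK.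
have wp2 : 2^-1 < w p2.
  have := HT0 p2; rewrite p2t => /(_ _ (lexx _)) tp2.
  have {}tp2 : tau p2 < (2 * C)^-1.
    rewrite tauE; suff : be - (2 * C)^-1 < s * pd t u p2 by lra.
    by apply: tp2 => i it; rewrite p2i// mxE subrr normr0 ler01.
  rewrite wE r2E big1 => [|i it]; last by rewrite p2i// expr0n.
  have Ct : C * tau p2 < 2^-1.
    have -> : 2^-1 = C * (2 * C)^-1 by rewrite invfM mulrCA mulfV ?mulr1// gt_eqF.
    by rewrite ltr_pM2l.
  have : 0 <= N * tau p2 ^+ 2 by rewrite mulr_ge0 ?sqr_ge0// ltW.
  lra.
pose T := 2 * T0 + 1.
have T_gt0 : 0 < T by rewrite /T; lra.
pose F : S := sconst T * w - sconst s * scoord t.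
have FE x : F x = T * w x - s * x 0 t.
  by rewrite /F !(smf_addE, smf_oppE, smf_mulE, sconstE, scoordE).
have LF : leg_lap F = sconst (2 * T).
  rewrite /F leg_lap_sub !leg_lap_constM Lw leg_lap_time mulr0 subr0.
  by apply: smf_ext => x; rewrite !smfE mulrC.
pose Q := [set x : V | forall i,
   (if i == t then Num.min 0 (s * T) else -1) <= x 0 i <=
   (if i == t then Num.max 0 (s * T) else 1)].
(* [Q] is the box [0 <= s t <= T], [|x_i| <= 1]; its description as a product of
   intervals depends on the sign of [s] *)
have QE x : Q x <-> 0 <= s * x 0 t <= T /\ forall i, i != t -> `|x 0 i| <= 1.
  have mM : Num.min 0 (s * T) <= x 0 t <= Num.max 0 (s * T) = (0 <= s * x 0 t <= T).
    case: s1 => ->; rewrite ?mulN1r ?mul1r.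
      by rewrite min_l ?max_r// ltW.
    have nT : - T <= 0 by rewrite oppr_le0 ltW.
    by rewrite (min_r nT) (max_l nT) oppr_ge0 (lerNl (x 0 t)) andbC.
  split=> [Qx|[xt xi] i].
    split; first by have := Qx t; rewrite eqxx mM.
    by move=> i it; have := Qx i; rewrite (negPf it) ler_norml.
  by case: eqP => [->|/eqP it]; rewrite ?mM// -ler_norml xi.
have Qp2 : Q p2.
  apply/QE; rewrite p2t; split; first by apply/andP; split; rewrite /T; lra.
  by move=> i it; rewrite p2i// normr0 ler01.
have [p Qp pmax] := EVT_max_rV (ex_intro _ p2 Qp2) (@box_compact _ _ _ _)
  (continuous_subspaceT (@smf_continuous _ _ F)).
have /QE[/andP[pt0 ptT] pi] : Q p by rewrite inE in Qp.
have Fp : 0 < F p.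
  have : F p2 <= F p by apply: pmax; rewrite inE.
  apply: lt_le_trans; rewrite FE p2t.
  have : T * 2^-1 < T * w p2 by rewrite ltr_pM2l.
  by rewrite /T; lra.
have wp : s * p 0 t < T * w p by move: Fp; rewrite FE; lra.
have wp0 : 0 < w p by rewrite -(pmulr_rgt0 _ T_gt0); lra.
have flatB : flat p \in B.
  rewrite inE => i; case: eqP => [->|/eqP it]; first by rewrite flat_t lexx.
  by rewrite flat_i// -ler_norml pi.
have taud' : tau p <= d'.
  apply: le_trans (qmax _ flatB); rewrite !tauE.
  by have := slope_mono pt0; lra.
have quad : N * tau p ^+ 2 <= N * d' * tau p.
  by rewrite expr2 mulrA ler_pM2r// ler_pM2l.
have dtau : 0 < d^-1 * tau p by rewrite mulr_gt0 ?invr_gt0.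
have r2p : r2 p < 1.
  by move: wp0; rewrite wE /C; lra.
have r2p0 : 0 <= r2 p by rewrite r2E; apply: sumr_ge0 => i _; exact: sqr_ge0.
have ptT' : s * p 0 t < T.
  apply: (lt_trans wp); rewrite gtr_pMr//.
  by rewrite wE /C; lra.
have pt0' : 0 < s * p 0 t.
  rewrite lt_neqAle pt0 andbT; apply/eqP => e.
  have pt : p 0 t = 0 by rewrite (sK (p 0 t)) -e mulr0.
  have fp : flat p = p by rewrite /flat pt scale0r subr0.
  rewrite fp in flatB; have dp := qmin _ flatB.
  have : 1 <= d^-1 * tau p by rewrite mulrC ler_pdivlMr// mul1r.
  by move: wp0; rewrite wE /C; lra.
have near_Q : \forall q \near p, F q <= F p.
  have c1 : \forall q \near p, 0 < (sconst s * scoord t) q.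
    have := @smf_continuous _ _ (sconst s * scoord t) p => /cvgr_gt; apply.
    by rewrite smf_mulE sconstE scoordE.
  have c2 : \forall q \near p, (sconst s * scoord t) q < T.
    have := @smf_continuous _ _ (sconst s * scoord t) p => /cvgr_lt; apply.
    by rewrite smf_mulE sconstE scoordE.
  have c3 : \forall q \near p, r2 q < 1.
    by have := @smf_continuous _ _ r2 p => /cvgr_lt; exact.
  apply: filterS3 c1 c2 c3 => z; rewrite smf_mulE sconstE scoordE => z1 z2 z3.
  apply: pmax; rewrite inE; apply/QE; split; first by rewrite !ltW.
  move=> i it; rewrite -(@expr_le1 _ 2)// real_normK ?num_real//.
  apply: le_trans (ltW z3); rewrite r2E (bigD1 i)//= lerDl.
  by apply: sumr_ge0 => k _; exact: sqr_ge0.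
have := leg_lap_max_test near_Q; rewrite LF sconstE; lra.
Qed.

End Slope.

(** [u_t] takes values beyond any bound in both time directions, uniformly for bounded [x];
    a bound on [u_t] therefore bounds [t]. *)
Lemma compact_balls (x0 : V) (r : R) :
  compact [set x | \sum_a (leg_coord a x - leg_coord a x0) ^+ 2 <= r ^+ 2].
Proof.
pose rho := `|r|.
have rho0 : 0 <= rho by exact: normr_ge0.
pose b := `|pd t u x0| + rho.
have [p hp] := slope_unbounded (or_introl erefl) b.
have [p' hp'] := slope_unbounded (or_intror erefl) b.
have [T T0 HT] := uniform_growth (or_introl erefl) hp x0 rho0.
have [T' T'0 HT'] := uniform_growth (or_intror erefl) hp' x0 rho0.
pose ph : S := \sum_a (leg_coord a - sconst (leg_coord a x0)) ^+ 2.
have phE x : ph x = \sum_a (leg_coord a x - leg_coord a x0) ^+ 2.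
  by rewrite /ph smf_sumE; apply: eq_bigr => a _; rewrite !smfE.
apply: (@subclosed_compact _ _ [set x : V | forall i,
    (if i == t then - T' else x0 0 i - rho) <= x 0 i <=
    (if i == t then T else x0 0 i + rho)]).
- have -> : [set x | \sum_a (leg_coord a x - leg_coord a x0) ^+ 2 <= r ^+ 2] =
      (ph : V -> R) @^-1` [set z | z <= r ^+ 2].
    by apply/seteqP; split=> x /=; rewrite phE.
  by apply: preimage_closed => [z _|]; [exact: smf_continuous|exact: closed_le].
- exact: box_compact.
move=> x /= Hx.
have Ya a : `|leg_coord a x - leg_coord a x0| <= rho.
  rewrite /rho -ler_sqr ?nnegrE// !real_normK ?num_real//.
  apply: le_trans Hx; rewrite (bigD1 a)//= lerDl.
  by apply: sumr_ge0 => k _; exact: sqr_ge0.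
have Yi i : i != t -> `|x 0 i - x0 0 i| <= rho.
  by move=> it; have := Ya i; rewrite /leg_coord (negPf it) !scoordE.
have Yt : `|pd t u x| <= b.
  have := Ya t; rewrite /leg_coord eqxx /b => H.
  rewrite -[pd t u x](subrK (pd t u x0)) (le_trans (ler_normD _ _))//.
  by rewrite addrC lerD2l.
move: Yt; rewrite ler_norml => /andP[Yt1 Yt2].
move=> i; case: eqP => [->|/eqP it]; last by have := Yi i it; rewrite ler_norml; lra.
apply/andP; split; rewrite leNgt; apply/negP => lt.
  by have := HT' x Yi; rewrite !mulN1r => H; have := H ltac:(lra); lra.
by have := HT x Yi; rewrite !mul1r => H; have := H (ltW lt); lra.
Qed.

(** * The gradient estimate and the Liouville theorem *)

(** The maximum of [ph ^+ 2 * |grad F| ^+ 2 / F ^+ 2] over the ball is attained in the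
    interior, as the cutoff [ph] vanishes on the boundary.  The test function [N] avoids
    the quotient: it has a local maximum at the same point and is polynomial in [F], its
    derivatives, and the coordinates. *)
Lemma gradient_estimate F (x0 : V) (r : R) : (forall x, 0 < F x) -> leg_lap F = 0 ->
  0 < r ->
  r ^+ 2 * \sum_a leg_d a F x0 ^+ 2 <= n%:R * (24 + 20 * n%:R) * F x0 ^+ 2.
Proof.
move=> F0 LF r0.
have n0 : (0 < n)%N by case: (n) t => // -[].
have nR : 0 < n%:R :> R by rewrite ltr0n.
pose Y a : S := leg_coord a - sconst (leg_coord a x0).
pose ph : S := sconst (r ^+ 2) - \sum_a Y a ^+ 2.
pose P : S := \sum_a leg_d a F ^+ 2.
have FN x : F x != 0 by rewrite gt_eqF.
pose G : S := ph ^+ 2 * P * sinv FN ^+ 2.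
pose B := [set x : V | \sum_a (leg_coord a x - leg_coord a x0) ^+ 2 <= r ^+ 2].
have phE x : ph x = r ^+ 2 - \sum_a (leg_coord a x - leg_coord a x0) ^+ 2.
  rewrite /ph !smfE; congr (_ - _); apply: eq_bigr => a _; by rewrite /Y !smfE.
have BE x : B x = (0 <= ph x) :> Prop by rewrite phE subr_ge0.
have ph0 : ph x0 = r ^+ 2.
  by rewrite phE big1 ?subr0// => a _; rewrite subrr expr0n.
have B0 : B !=set0 by exists x0; rewrite BE ph0 sqr_ge0.
have [p Bp pmax] := EVT_max_rV B0 (@compact_balls x0 r)
  (continuous_subspaceT (@smf_continuous _ _ G)).
rewrite inE BE in Bp.
have GE x : G x * F x ^+ 2 = ph x ^+ 2 * P x.
  by rewrite /G !smfE exprVn mulfVK// expf_neq0.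
have P_ge0 x : 0 <= P x.
  by rewrite /P smf_sumE; apply: sumr_ge0 => a _; rewrite smf_expE sqr_ge0.
set m := G p in pmax.
suff mle : m <= n%:R * (24 + 20 * n%:R) * r ^+ 2.
  have : G x0 <= m by apply: pmax; rewrite inE BE ph0 sqr_ge0.
  move=> /le_trans/(_ mle); rewrite -(ler_pM2r (exprn_gt0 2 (F0 x0))) GE ph0 => H.
  have -> : \sum_a leg_d a F x0 ^+ 2 = P x0.
    by rewrite /P smf_sumE; apply: eq_bigr => a _; rewrite smf_expE.
  by rewrite -(ler_pM2l (exprn_gt0 2 r0)); move: H; lra.
have C0 : 0 <= n%:R * (24 + 20 * n%:R) :> R by rewrite mulr_ge0// addr_ge0// mulr_ge0.
have [m0|m0] := leP m 0.
  by rewrite (le_trans m0)// mulr_ge0// sqr_ge0.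
have F2 : 0 < F p ^+ 2 by rewrite exprn_gt0.
have phP : 0 < ph p ^+ 2 * P p by rewrite -GE mulr_gt0.
have php : 0 < ph p.
  rewrite lt_neqAle Bp andbT eq_sym; apply/eqP => e.
  by move: phP; rewrite e expr0n mul0r ltxx.
have Pp : 0 < P p by move: phP; rewrite pmulr_rgt0// exprn_gt0.
pose N : S := ph * ph * P - sconst m * (F * F).
have Nmax : \forall q \near p, N q <= N p.
  have : \forall q \near p, 0 < ph q.
    by have := @smf_continuous _ _ ph p => /cvgr_gt; exact.
  apply: filterS => q phq.
  have Nval x : N x = F x ^+ 2 * (G x - m).
    by rewrite mulrBr mulrC GE /N !smfE; ring.
  rewrite !Nval subrr mulr0 pmulr_rle0 ?exprn_gt0// subr_le0.
  by apply: pmax; rewrite inE BE ltW.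
have leg_d_ph c : leg_d c ph = - (2 * Y c).
  rewrite /ph leg_d_sub leg_d_const sub0r raddf_sum/= (bigD1 c)//= big1 ?addr0 => [|a ac].
    by rewrite expr2 leg_d_mul /Y leg_d_sub leg_d_const leg_d_coord eqxx subr0/=; ring.
  by rewrite expr2 leg_d_mul /Y leg_d_sub leg_d_const leg_d_coord eq_sym (negPf ac) /=; ring.
have leg_lap_ph : leg_lap ph = - (2 * n%:R).
  rewrite /leg_lap (eq_bigr (fun=> - (2 : S))) => [|c _].
    by rewrite sumr_const card_ord mulNrn mulr_natr.
  rewrite leg_d_ph raddfN/= mulrDl mul1r raddfD/= /Y leg_d_sub leg_d_const leg_d_coord eqxx subr0.
  by rewrite -[1 *+ _ + _]mulr2n.
have leg_d_P c : leg_d c P = 2 * \sum_a leg_d a F * leg_d c (leg_d a F).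
  rewrite /P raddf_sum mulr_sumr; apply: eq_bigr => a _ /=.
  by rewrite expr2 leg_d_mul; ring.
have leg_lap_P : leg_lap P = 2 * \sum_c \sum_a leg_d c (leg_d a F) ^+ 2.
  have -> : leg_lap P = \sum_a leg_lap (leg_d a F ^+ 2).
    rewrite /leg_lap exchange_big; apply: eq_bigr => c _ /=.
    by rewrite /P !raddf_sum.
  rewrite [in RHS]exchange_big mulr_sumr; apply: eq_bigr => a _ /=.
  by rewrite expr2 leg_lap_mul leg_lap_d LF raddf0 mulr0 !add0r.
pose W : S := \sum_c \sum_a leg_d c (leg_d a F) ^+ 2.
pose r2 : S := \sum_a Y a ^+ 2.
pose A : S := \sum_c leg_d c ph * leg_d c P.
have leg_lap_N : leg_lap N = 2 * ph ^+ 2 * W + P * (8 * r2 - 4 * n%:R * ph) + 4 * ph * A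
    - 2 * sconst m * P.
  have Lpp : leg_lap (ph * ph) = 8 * r2 - 4 * n%:R * ph.
    rewrite leg_lap_mul leg_lap_ph; have -> : \sum_a leg_d a ph * leg_d a ph = 4 * r2; last by ring.
    by rewrite mulr_sumr; apply: eq_bigr => a _; rewrite leg_d_ph; ring.
  have LFF : leg_lap (F * F) = 2 * P.
    by rewrite leg_lap_mul LF mulr0 !add0r.
  have cross : \sum_a leg_d a (ph * ph) * leg_d a P = 2 * ph * A.
    by rewrite mulr_sumr; apply: eq_bigr => a _; rewrite leg_d_mul; ring.
  have cross0 : \sum_a leg_d a (sconst m) * leg_d a (F * F) = 0.
    by apply: big1 => a _; rewrite leg_d_const mul0r.
  rewrite /N leg_lap_sub !(leg_lap_mul (_ * _)) (leg_lap_mul (sconst m)).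
  by rewrite Lpp LFF leg_lap_const leg_lap_P cross cross0 -/W; ring.
have := @gradient_bound_algebra R n (F p) (ph p) m (\sum_a (Y a p) ^+ 2)
  (fun c => leg_d c F p) (fun c => leg_d c ph p) (fun c => leg_d c P p)
  (fun c a => leg_d c (leg_d a F) p) n0 (F0 p) php.
have PE : \sum_c leg_d c F p ^+ 2 = P p.
  by rewrite /P smf_sumE; apply: eq_bigr => c _; rewrite smf_expE.
rewrite PE => /(_ Pp) main.
have r2E : \sum_a Y a p ^+ 2 = r ^+ 2 - ph p.
  rewrite phE opprB addrC subrK.
  by apply: eq_bigr => a _; rewrite /Y !smfE.
apply: (le_trans (main _ _ _ _ _ _)).
- rewrite mulr_sumr; apply: eq_bigr => c _.
  by rewrite leg_d_ph !smfE; ring.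
- by rewrite -GE.
- by move=> c; rewrite leg_d_P smf_mulE smf_natE smf_sumE.
- move=> c; have [+ _] := leg_d_max_test Nmax c.
  rewrite /N leg_d_sub !leg_d_mul leg_d_const !smfE => e; rewrite -[RHS]e; ring.
- by have := congr1 (fun G : S => G p) LF; rewrite /leg_lap smf_sumE.
- have := leg_lap_max_test Nmax; rewrite leg_lap_N.
  rewrite !(smf_addE, smf_oppE, smf_mulE, smf_natE, smf_expE, sconstE).
  have -> : A p = \sum_c leg_d c ph p * leg_d c P p by rewrite /A smf_sumE.
  have -> : r2 p = \sum_a Y a p ^+ 2.
    by rewrite /r2 smf_sumE; apply: eq_bigr => a _; rewrite smf_expE.
  have -> : W p = \sum_c \sum_a leg_d c (leg_d a F) p ^+ 2.
    rewrite /W smf_sumE; apply: eq_bigr => c _; rewrite smf_sumE.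
    by apply: eq_bigr => a _; rewrite smf_expE.
  by [].
rewrite r2E -[leRHS]mulrA ler_pM2l//.
have : 0 <= n%:R * ph p by rewrite mulr_ge0.
have : 0 <= n%:R * r ^+ 2 by rewrite mulr_ge0// sqr_ge0.
move: Bp; lra.
Qed.

Lemma liouville F : (forall x, 0 < F x) -> leg_lap F = 0 -> forall a, leg_d a F = 0.
Proof.
move=> F0 LF a; apply: smf_ext => x.
have est := @gradient_estimate F x _ F0 LF.
set C := _ * F x ^+ 2 in est.
set Q := \sum_a _ in est.
have Q0 : 0 <= Q by apply: sumr_ge0 => b _; exact: sqr_ge0.
have C0 : 0 <= C by rewrite mulr_ge0 ?sqr_ge0// mulr_ge0// addr_ge0// mulr_ge0.
have : Q = 0.
  apply/eqP; rewrite eq_le Q0 andbT leNgt; apply/negP => Qp.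
  have r0 : 0 < 1 + C / Q by rewrite ltr_pwDl// divr_ge0// ltW.
  have := est _ r0; apply/negP; rewrite -ltNge.
  have -> : C = C / Q * Q by rewrite divfK// gt_eqF.
  have : 0 <= C / Q by rewrite divr_ge0// ltW.
  rewrite mulrK ?unitfE ?gt_eqF//.
  by set z := C / Q => z0; rewrite ltr_pM2r//; nra.
move/eqP; rewrite psumr_eq0 => [|b _]; last exact: sqr_ge0.
by move/allP => /(_ a (mem_index_enum _)); rewrite sqrf_eq0 => /eqP.
Qed.

Lemma positive_harmonic_constant F :
  (forall x, 0 < F x) -> leg_lap F = 0 -> forall i, pd i F = 0.
Proof.
move=> F0 LF i.
have XF := liouville F0 LF.
have DtF : pd t F = 0.
  have := XF t; rewrite leg_dtE; apply: smf_mulI => x.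
  by rewrite gt_eqF// inv_utt_gt0.
have [->//|it] := eqVneq i t.
by have := XF i; rewrite leg_diE// DtF mulr0 subr0.
Qed.

(** * Vanishing of the third derivatives *)

Lemma pd_utt i : pd i (pd t (pd t u)) = 0.
Proof.
have := positive_harmonic_constant inv_utt_gt0 leg_lap_inv_utt i.
rewrite pd_inv_utt => /eqP; rewrite oppr_eq0 => /eqP; apply: smf_mulI => x.
by rewrite smf_mulE mulf_neq0// gt_eqF// inv_utt_gt0.
Qed.

(** The second derivative of [u] in the direction [e_i + e_j]. *)
Let diag_hess i j : S := pd i (pd i u) + pd j (pd j u) + 2 * pd i (pd j u).

Let pd_diag_hess l i j : pd l (diag_hess i j) =
  pd l (pd i (pd i u)) + pd l (pd j (pd j u)) + 2 * pd l (pd i (pd j u)).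
Proof. by rewrite /diag_hess !pd_add pd_double. Qed.

Let diag_hess_ge0 i j x : 0 <= diag_hess i j x.
Proof.
have := convex_hessian u_convex x (1 *: delta_mx 0 i + delta_mx 0 j).
rewrite !dird_addZ !dird_delta !(pd_add, pd_mul, pd_sconst).
rewrite /diag_hess !(smf_addE, smf_mulE, sconstE, smf_0E, smf_1E).
by rewrite (clairaut j i u); lra.
Qed.

Let pd_polarization l : (forall i j, pd l (diag_hess i j) = 0) ->
  forall i j, pd l (pd i (pd j u)) = 0.
Proof.
move=> DH.
have two0 (x : V) : (2 : S) x != 0 by rewrite smf_natE.
have E i j : pd l (pd i (pd i u)) + pd l (pd j (pd j u)) + 2 * pd l (pd i (pd j u)) = 0.
  by rewrite -[RHS](DH i j) pd_diag_hess.
have Ei i : pd l (pd i (pd i u)) = 0.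
  apply: (smf_mulI two0); apply: (smf_mulI two0).
  by rewrite -[RHS](E i i); ring.
move=> i j; apply: (smf_mulI two0).
by have := E i j; rewrite (Ei i) (Ei j) !add0r.
Qed.

(** With [u_tt] constant, second derivatives are affine in [t]; convexity forces the slope
    to vanish. *)
Lemma pdt_hessian i j : pd t (pd i (pd j u)) = 0.
Proof.
apply: pd_polarization => {}i {}j; apply: ge0_affine; first exact: diag_hess_ge0.
have tt k l : pd t (pd t (pd k (pd l u))) = 0.
  by rewrite (clairaut t k (pd l u)) (clairaut t k (pd t (pd l u))) (clairaut t l u)
    (clairaut t l (pd t u)) (pd_utt l) raddf0.
by rewrite pd_diag_hess !pd_add pd_double !tt mulr0 !addr0.
Qed.

Let lap F : S := \sum_(a | a != t) pd a (pd a F).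

Let lap_D i F : lap (pd i F) = pd i (lap F).
Proof.
rewrite /lap raddf_sum; apply: eq_bigr => a _ /=.
by rewrite (clairaut a i F) (clairaut a i (pd a F)).
Qed.

Let pd_lap_u i : pd i (lap u) = 0.
Proof.
have sq0 : pd i (\sum_(a | a != t) pd t (pd a u) ^+ 2) = 0.
  rewrite raddf_sum big1// => a _ /=.
  by rewrite expr2 pd_mul (clairaut i t (pd a u)) (pdt_hessian i a); ring.
have := congr1 (pd i) u_eq; rewrite pd_1 pd_sub pd_mul pd_utt mulr0 addr0 sq0 subr0.
by apply: smf_mulI => x; exact: utt_neq0.
Qed.

Let leg_lap_lap F : pd t F = 0 -> leg_lap F = lap F.
Proof.
move=> dF; rewrite /leg_lap /lap (bigD1 t)//= !leg_dtE dF mulr0 raddf0 mulr0 add0r.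
apply: eq_bigr => a ta.
by rewrite !leg_diE// dF mulr0 subr0 (clairaut t a F) dF !raddf0 mulr0 subr0.
Qed.

(** As [u_tt] and the [u_ti] are constant, the equation makes the spatial Laplacian of [u]
    constant, so second derivatives in [e_j + e_k] are harmonic; they are nonnegative
    by convexity. *)
Lemma third_derivatives0 i j k : pd i (pd j (pd k u)) = 0.
Proof.
apply: pd_polarization => {}j {}k.
have LH : leg_lap (1 + diag_hess j k) = 0.
  rewrite leg_lap_lap; last first.
    by rewrite pd_add pd_1 add0r pd_diag_hess !pdt_hessian mulr0 !addr0.
  have lap_DD a b : lap (pd a (pd b u)) = 0 by rewrite !lap_D pd_lap_u raddf0.
  have lapD F G : lap (F + G) = lap F + lap G.
    by rewrite /lap -big_split; apply: eq_bigr => a _; rewrite !pd_add.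
  have -> : diag_hess j k = pd j (pd j u) + pd k (pd k u) + (pd j (pd k u) + pd j (pd k u)).
    by rewrite /diag_hess; ring.
  rewrite !lapD !lap_DD !addr0 /lap big1// => a _.
  by rewrite pd_1 raddf0.
have H1 x : 0 < (1 + diag_hess j k) x by rewrite smf_addE smf_1E ltr_pwDl.
by have := positive_harmonic_constant H1 LH i; rewrite pd_add pd_1 add0r.
Qed.

End Frame.

Theorem theorem1 (R : realType) (n : nat) (hn : (2 <= n)%N)
    (u : 'rV[R]_n -> R)
    (u_smooth : smooth u)
    (u_convex : convex_function (E := 'rV[R]_n) [set: 'rV[R]_n] u)
    (u_eq : forall x : 'rV[R]_n, donaldson (Ordinal (ltnW hn)) u x = 1) :
  quadratic u.
Proof.
pose t := Ordinal (ltnW hn).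
pose U : smf R n := Smf (introT (smooth_predP u) u_smooth).
have DDE i j : pd i (pd j U) = partial2 i j u :> ('rV[R]_n -> R).
  have Dfun k (F : smf R n) : pd k F = partial k F :> ('rV[R]_n -> R).
    by apply/funext => x; rewrite pdE.
  by rewrite !Dfun.
have U_eq : pd t (pd t U) * (\sum_(i < n | i != t) pd i (pd i U))
  - \sum_(i < n | i != t) pd t (pd i U) ^+ 2 = 1.
  apply: smf_ext => x; rewrite smf_1E -[RHS](u_eq x) /donaldson.
  rewrite smf_addE smf_oppE smf_mulE !smf_sumE DDE.
  by congr (_ * _ - _); apply: eq_bigr => i _; rewrite ?smf_expE DDE.
apply: (@third_derivatives0_quadratic _ _ U) => i j k.
exact: (@third_derivatives0 _ _ t U u_convex U_eq).
Qed.
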